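(* Let $k\ge1$, let $Q\in\mathbb{R}^{d\times d}$ be skew-symmetric, $M\in\mathbb{R}^{d\times d}$ symmetric, $A=QM$, let $U:\mathbb{R}^d\to\mathbb{R}$ be a polynomial of degree $k+2$, and let $x(t)$ be the exact solution of $\dot x=QMx+Q\nabla U(x)$ on $[0,T]$, assumed to stay in a bounded set $\mathcal D\subset\mathbb{R}^d$. Write $\tilde x_n=x(t_n)$ with $t_n=nh$. Let $C>0$ be a constant independent of $h$, and suppose the starting values $x_0,\ldots,x_{k-1}$ (which may depend on $h$) satisfy $\|x_j-\tilde x_j\|\le Ch^2$ for $j=0,\ldots,k-1$. Then there exist $h_0>0$ and $C_T>0$, independent of $h$, such that for $0<h\le h_0$ the numerical solution generated by the $k$-step EKahan scheme $$x_{n+k}=e^{khA}x_n+kh\,\phi(khA)\,Q\,\nabla_{\mathrm K}U(x_n,x_{n+1},\ldots,x_{n+k})$$ satisfies $$\max_{0\le n\le N}\|x_n-\tilde x_n\|\le C_T\,h^2,\qquad N=\lfloor T/h\rfloor,$$ i.e. the $k$-step EKahan scheme is globally second order on finite time intervals.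
   Context: $\|\cdot\|$ denotes a vector norm on $\mathbb{R}^d$ and the induced matrix norm. $\phi(z)=\frac{e^z-1}{z}$ (entire, $\phi(0)=1$), applied to matrices through its power series. Polarized gradient $\nabla_{\mathrm K}U$: if $U$ is homogeneous of degree $k+2$, $$\nabla_{\mathrm K}U(x_n,\ldots,x_{n+k})=\sum_{\substack{1\le m\le k+1\\ n\le i_1<\cdots<i_m\le n+k}}\frac{(-1)^{k+1-m}}{(k+1)!}\,\nabla U(x_{i_1}+\cdots+x_{i_m}),$$ the symmetric $(k+1)$-linear polarization of $\nabla U$. If $U$ is a nonhomogeneous polynomial of degree $k+2$, let $\bar U(s,x)$ be the homogeneous polynomial of degree $k+2$ in $(s,x)\in\mathbb{R}\times\mathbb{R}^d$ with $\bar U(1,x)=U(x)$; then $\nabla_{\mathrm K}U(x_n,\ldots,x_{n+k})$ is the $x$-component of the polarization of $\nabla\bar U$ at $(1,x_n),\ldots,(1,x_{n+k})$, i.e. the same sum with $\nabla U(x_{i_1}+\cdots+x_{i_m})$ replaced by $\nabla_x\bar U(m,x_{i_1}+\cdots+x_{i_m})$. *)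

(* Defs.v *)
From HB Require Import structures.
From mathcomp Require Import all_boot all_order all_algebra.
From mathcomp Require Import all_classical all_reals all_analysis.
(* Only the structures of [mpoly] are imported: its notations clash with those
   of MathComp-Analysis. *)
From mathcomp Require mpoly.
Export (canonicals, coercions) mpoly.
Set Implicit Arguments.
Unset Strict Implicit.
Unset Printing Implicit Defensive.
Import Order.TTheory GRing.Theory Num.Theory.
Import numFieldNormedType.Exports.
Local Open Scope classical_set_scope.
Local Open Scope ring_scope.

Definition vector_norm (R : realType) (d : nat) (nrm : 'cV[R]_d -> R) : Prop :=
  [/\ forall v, 0 <= nrm v,
      forall v, nrm v = 0 -> v = 0,
      forall (a : R) v, nrm (a *: v) = `|a| * nrm v
    & forall u v, nrm (u + v) <= nrm u + nrm v].

Definition mx_pseries (R : realType) (d : nat) (c : nat -> R) (A : 'M[R]_d)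
    : 'M[R]_d :=
  limn (series (fun l => c l *: A ^+ l)).

Definition expmx (R : realType) (d : nat) (A : 'M[R]_d) : 'M[R]_d :=
  mx_pseries (fun l => (l`!%:R)^-1) A.

(* phi z = (exp z - 1) / z = \sum_l z ^ l / (l + 1)! *)
Definition phimx (R : realType) (d : nat) (A : 'M[R]_d) : 'M[R]_d :=
  mx_pseries (fun l => (l.+1`!%:R)^-1) A.

Definition mgrad (R : realType) (d : nat) (U : mpoly.mpoly d R) (v : 'cV[R]_d)
    : 'cV[R]_d :=
  \col_i mpoly.meval (fun j => v j ord0) (mpoly.mderiv i U).

(* The point (s, v) of R x R^d: variable [ord0] is s, and variable
   [lift ord0 i] is the i-th coordinate of v. *)
Definition cons_point (R : realType) (d : nat) (s : R) (v : 'cV[R]_d)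
    (j : 'I_d.+1) : R :=
  if unlift ord0 j is Some i then v i ord0 else s.

(* x ^ m of degree at most D becomes s ^ (D - |m|) * x ^ m. *)
Definition homog_mnm (d D : nat) (m : mpoly.multinom d) : mpoly.multinom d.+1 :=
  mpoly.Multinom
    [tuple (if unlift ord0 j is Some i then m i
      else (D - mpoly.mdeg m)%N)
      | j < d.+1].

Definition homogenize (R : realType) (d D : nat) (U : mpoly.mpoly d R)
    : mpoly.mpoly d.+1 R :=
  \sum_(m <- mpoly.msupp U)
    mpoly.mcoeff m U *: mpoly.mpolyX R (homog_mnm D m).

(* The x-component of the gradient of a polynomial in (s, x), at (s, v). *)
Definition mgrad_x (R : realType) (d : nat) (V : mpoly.mpoly d.+1 R)
    (s : R) (v : 'cV[R]_d) : 'cV[R]_d :=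
  \col_i mpoly.meval (cons_point s v) (mpoly.mderiv (lift ord0 i) V).

(* A nonempty S stands for the index tuple i_1 < ... < i_m with m = #|S|.
   For homogeneous U the homogenization does not involve s, and this is the
   polarization of the gradient of U itself; see [gradK_homog]. *)
Definition gradK (R : realType) (d k : nat) (U : mpoly.mpoly d R)
    (v : 'I_k.+1 -> 'cV[R]_d) : 'cV[R]_d :=
  \sum_(S : {set 'I_k.+1} | S != finset.set0)
    ((-1) ^+ (k.+1 - #|S|) / (k.+1)`!%:R) *:
      mgrad_x (homogenize k.+2 U) (#|S|)%:R (\sum_(i in S) v i).

(* x is differentiable on [0, T] (one-sidedly at the endpoints), with
   derivative f (x t) at t. *)
Definition solves_ode (R : realType) (d : nat) (f : 'cV[R]_d -> 'cV[R]_d)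
    (T : R) (x : R -> 'cV[R]_d) : Prop :=
  forall t, t \in `[0, T] ->
    (fun s => (s - t)^-1 *: (x s - x t)) @ within `[0, T] t^' --> f (x t).

Definition ekahan_scheme (R : realType) (d k : nat) (Q M : 'M[R]_d)
    (U : mpoly.mpoly d R) (h : R) (N : nat) (y : nat -> 'cV[R]_d) : Prop :=
  forall n, (n + k <= N)%N ->
    y (n + k)%N =
      expmx ((k%:R * h) *: (Q *m M)) *m y n
      + (k%:R * h) *: (phimx ((k%:R * h) *: (Q *m M)) *m Q
                         *m gradK U (fun i : 'I_k.+1 => y (n + i)%N)).

(* y is, up to step N, a numerical solution with starting values
   y_0 = s_0, ..., y_{k-1} = s_{k-1}; terms beyond step N are irrelevant. *)
Definition ekahan_solution (R : realType) (d k : nat) (Q M : 'M[R]_d)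
    (U : mpoly.mpoly d R) (h : R) (N : nat) (s : 'I_k -> 'cV[R]_d)
    (y : nat -> 'cV[R]_d) : Prop :=
  (forall j : 'I_k, y j = s j) /\ ekahan_scheme k Q M U h N y.

Section HomogenizeTheory.
Variables (R : realType) (d D : nat) (U : mpoly.mpoly d R).

Let homog_mnm0 (m : mpoly.multinom d) :
  homog_mnm D m ord0 = (D - mpoly.mdeg m)%N.
Proof. by rewrite mpoly.mnmE unlift_none. Qed.

Let homog_mnmS (m : mpoly.multinom d) i : homog_mnm D m (lift ord0 i) = m i.
Proof. by rewrite mpoly.mnmE liftK. Qed.

Lemma homogenize_dhomog : (mpoly.msize U <= D.+1)%N ->
  homogenize D U \is mpoly.ishomog1 D mpoly.mdeg.
Proof.
move=> hU; rewrite /homogenize big_seq; apply: rpred_sum => m hm.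
apply: rpredZ; rewrite mpoly.dhomogX /= mpoly.mdegE big_ord_recl homog_mnm0.
under eq_bigr do rewrite homog_mnmS.
by rewrite -mpoly.mdegE subnK // -ltnS (leq_trans _ hU) // mpoly.msize_mdeg_lt.
Qed.

(* Dehomogenization at s = 1. *)
Lemma homogenize1 (v : 'cV[R]_d) :
  mpoly.meval (cons_point 1 v) (homogenize D U)
  = mpoly.meval (fun i => v i ord0) U.
Proof.
rewrite /homogenize raddf_sum [in RHS](mpoly.mpolyE U) raddf_sum /=.
apply: eq_bigr => m _; rewrite !mpoly.mevalZ !mpoly.mevalX big_ord_recl.
rewrite homog_mnm0 /cons_point unlift_none expr1n mul1r; congr (_ * _).
by apply: eq_bigr => i _; rewrite homog_mnmS liftK.
Qed.

Lemma mgrad_x_homog s v : U \is mpoly.ishomog1 D mpoly.mdeg ->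
  mgrad_x (homogenize D U) s v = mgrad U v.
Proof.
move=> /mpoly.dhomogP hU; apply/colP => i; rewrite !mxE.
rewrite /homogenize [in RHS](mpoly.mpolyE U).
rewrite (linear_sum (mpoly.mderiv (lift ord0 i))) (linear_sum (mpoly.mderiv i)).
rewrite !raddf_sum /=.
apply: eq_big_seq => m /hU hm.
rewrite !mpoly.mderivZ !mpoly.mevalZ !mpoly.mderivX !mpoly.mevalZ homog_mnmS.
congr (_ * (_ * _)); rewrite !mpoly.mevalX big_ord_recl.
rewrite mpoly.mnmBE mpoly.mnm1E homog_mnm0 hm subnn sub0n expr0 mul1r.
apply: eq_bigr => j _; rewrite !mpoly.mnmBE !mpoly.mnm1E homog_mnmS.
by rewrite (inj_eq lift_inj) /cons_point liftK.
Qed.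

End HomogenizeTheory.

Lemma gradK_homog (R : realType) (d k : nat) (U : mpoly.mpoly d R)
    (v : 'I_k.+1 -> 'cV[R]_d) : U \is mpoly.ishomog1 k.+2 mpoly.mdeg ->
  gradK U v =
    \sum_(S : {set 'I_k.+1} | S != finset.set0)
      ((-1) ^+ (k.+1 - #|S|) / (k.+1)`!%:R) *: mgrad U (\sum_(i in S) v i).
Proof. by move=> hU; apply: eq_bigr => S _; rewrite mgrad_x_homog. Qed.

(* Main.v *)
Require Import Defs.
From HB Require Import structures.
From mathcomp Require Import all_boot all_order all_algebra.
From mathcomp Require Import all_classical all_reals all_analysis.
From mathcomp Require Import ring lra.
Import Order.TTheory GRing.Theory Num.Theory.
Import numFieldNormedType.Exports.
Local Open Scope classical_set_scope.
Local Open Scope ring_scope.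

(** Write F(v) = A v + Q grad U(v) for the vector field, G for the polarized
gradient, H = k h for the time spanned by one application of the scheme,
and c for the midpoint of that time interval.

Local error.  G is symmetric, affine in each argument, and equal to grad U on
the diagonal ([gradK_rev], [gradK_affine], [gradK_diag]).  The exact values
x(t + j h) lie symmetrically about x(c) up to O(h^2), and reversing the
arguments of G does not change its value; hence the first-order term of G at
(x(c), ..., x(c)) cancels and G(x(t), ..., x(t + k h)) = grad U(x(c)) + O(h^2)
([gradK_consistency]).  The same symmetry gives
x(c + r) - x(c - r) = 2 r F(x(c)) + O(r^3) ([trajectory_midpoint]), since the
derivative of the left side is F(x(c + r)) + F(x(c - r)) = 2 F(x(c)) + O(r^2).
With exp Z = 1 + Z phi(Z) and phi(Z) = 1 + Z / 2 + O(|Z|^2), the exact solution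
therefore satisfies the scheme up to O(h^3) ([local_error]).  All these
estimates come from the fact that polynomial maps have first differences O(r)
and second symmetric differences O(r^2) on bounded sets ([quad_regular]).

Stability.  As G is affine in its last argument, one step is a linear equation
for the new value, with a matrix that is a small perturbation of the identity.
It has exactly one solution, and a window of k values with error at most m <= 1
yields a new error at most (1 + K h) m + K h^3 ([ekahan_step_stable]).  The
recursion W 0 = C h^2, W (n + 1) = (1 + K h) W n + K h^3 has a solution bounded
by e^(K T) (C + 1) h^2 for n h <= T.  For small h this is at most 1, so the
numerical values never leave the bounded set on which the constants hold, and an
induction on n gives existence, uniqueness and the error bound together.

The estimates are done in the sup norm; the given norm enters through the
equivalence of norms. *)

Set Implicit Arguments.
Unset Strict Implicit.
Unset Printing Implicit Defensive.

(** * Polarization of polynomials and of the gradient *)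

(** Expanding the product over j of 1 - [j is not in A] gives one term for each
subset of indices at which the 1 is taken, and only supersets of A survive. *)
Lemma sum_sign_supersets (K : comRingType) (n : nat) (A : {set 'I_n}) :
  \sum_(S : {set 'I_n} | A \subset S) (-1) ^+ (n - #|S|)
  = (A == [set: 'I_n]%SET)%:R :> K.
Proof.
have -> : (A == [set: 'I_n]%SET)%:R
    = \prod_(j : 'I_n) (1 + - (j \notin A)%:R) :> K.
  case: eqP => [->|/eqP AT].
    by rewrite big1 // => j _; rewrite inE subr0.
  have /fintype.subsetPn[j _ jA] : ~~ ([set: 'I_n]%SET \subset A).
    by rewrite finset.subTset.
  by rewrite (bigD1 j) //= jA subrr mul0r.
rewrite bigA_distr big_mkcond; apply: eq_bigr => S _.
case: (boolP (A \subset S)) =>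
  [/fintype.subsetP AS|/fintype.subsetPn[j jA jS]]; last first.
  by rewrite (bigD1 j) //= (negbTE jS) jA oppr0 mul0r.
rewrite (bigID (mem S)) /= big1 ?mul1r => [|j ->//].
rewrite (eq_bigr (fun=> -1)) => [|j jS]; last first.
  by rewrite (negbTE jS) (contra (AS j) jS).
rewrite prodr_const; congr (_ ^+ _).
by rewrite -[X in (X - _)%N](card_ord n) -(cardC S) addKn.
Qed.

(** Ryser's formula for the permanent: expand each product over functions f;
inclusion-exclusion over the sets S that contain the image of f keeps only the
surjective ones. *)
Lemma ryser_expansion (K : comRingType) (n : nat) (a : 'I_n -> 'I_n -> K) :
  \sum_(S : {set 'I_n}) (-1) ^+ (n - #|S|) * \prod_l \sum_(j in S) a l j
  = \sum_(f : {ffun 'I_n -> 'I_n} | injectiveb f) \prod_l a l (f l).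
Proof.
have expand (S : {set 'I_n}) : \prod_l \sum_(j in S) a l j
    = \sum_(f : {ffun 'I_n -> 'I_n} | f @: [set: 'I_n]%SET \subset S)
        \prod_l a l (f l).
  rewrite bigA_distr_big; apply: eq_bigl => f; apply/ffun_onP/fintype.subsetP.
    by move=> fS j /finset.imsetP[l _ ->].
  by move=> fS l; apply/fS/imset_f; rewrite inE.
under eq_bigr do rewrite expand big_distrr /= big_mkcond.
rewrite exchange_big /= [RHS]big_mkcond /=; apply: eq_bigr => f _.
rewrite -big_mkcond -big_distrl /= sum_sign_supersets.
suff -> : (f @: [set: 'I_n]%SET == [set: 'I_n]%SET) = injectiveb f.
  by case: ifP; rewrite ?mul1r ?mul0r.
rewrite eqEcard finset.subsetT /=; apply/idP/injectiveP => [le|fi].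
  have /imset_injP fi : #|f @: [set: 'I_n]%SET| == #|[set: 'I_n]%SET|.
    by rewrite eqn_leq leq_imset_card le.
  by move=> x y; apply: fi; rewrite inE.
by rewrite card_imset.
Qed.

(** Ryser's formula needs a monomial as a product indexed by 'I_n, one variable
for each factor, instead of a product of powers. *)
Lemma monomial_factors (m n : nat) (mm : mpoly.multinom m) :
  mpoly.mdeg mm = n -> exists c : 'I_n -> 'I_m,
  forall (K : comRingType) (u : 'I_m -> K),
    \prod_i u i ^+ mm i = \prod_l u (c l).
Proof.
pose s := flatten [seq nseq (mm i) i | i <- enum 'I_m].
have sz : size s = mpoly.mdeg mm.
  rewrite size_flatten /shape -map_comp sumnE big_map mpoly.mdegE big_enum.
  by apply: eq_bigr => i _ /=; rewrite size_nseq.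
move=> <-; rewrite -sz; exists (tnth (in_tuple s)) => K u.
rewrite -(big_tuple _ _ (in_tuple s) xpredT u) /= big_flatten big_map big_enum.
by apply: eq_bigr => i _; rewrite big_nseq iter_mulr mulr1.
Qed.

(** The polarization of W at the vectors w_0, ..., w_(n-1), times n!, when W is
homogeneous of degree n. *)
Definition polar_sum (R : comRingType) (n m : nat) (W : mpoly.mpoly m R)
    (w : 'I_n -> 'I_m -> R) : R :=
  \sum_(S : {set 'I_n} | S != finset.set0)
    (-1) ^+ (n - #|S|) * mpoly.meval (fun c => \sum_(j in S) w j c) W.

Definition set_arg (n : nat) (T : Type) (j0 : 'I_n) (w : 'I_n -> T) (u : T)
    (j : 'I_n) : T := if j == j0 then u else w j.

Section PolarSum.
Variables (R : comRingType) (n m : nat).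
Implicit Types (W : mpoly.mpoly m R) (w : 'I_n -> 'I_m -> R).

Lemma polar_sum_monomials W w :
  polar_sum W w = \sum_(mm <- mpoly.msupp W)
    mpoly.mcoeff mm W * polar_sum (mpoly.mpolyX R mm) w.
Proof.
rewrite /polar_sum; under [RHS]eq_bigr do rewrite big_distrr /=.
rewrite exchange_big /=; apply: eq_bigr => S _.
rewrite mpoly.mevalE big_distrr /=; apply: eq_bigr => mm _.
by rewrite mpoly.mevalX mulrCA.
Qed.

(** The empty set, which the polarization leaves out, contributes the value of a
monomial of positive degree at 0, which is 0, so that Ryser's formula applies. *)
Lemma polar_sum_monomialE (mm : mpoly.multinom m) :
  (0 < n)%N -> mpoly.mdeg mm = n -> exists c : 'I_n -> 'I_m,
  (forall u : 'I_m -> R, mpoly.meval u (mpoly.mpolyX R mm) = \prod_l u (c l)) /\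
  (forall w, polar_sum (mpoly.mpolyX R mm) w =
    \sum_(f : {ffun 'I_n -> 'I_n} | injectiveb f) \prod_l w (f l) (c l)).
Proof.
move=> n_gt0 /monomial_factors[c cE]; exists c; split=> [u|w].
  by rewrite mpoly.mevalX cE.
rewrite -(ryser_expansion (fun l j => w j (c l))).
rewrite [RHS](bigD1 finset.set0) //= [X in X + _](_ : _ = 0) ?add0r.
  by apply: eq_bigr => S _; rewrite mpoly.mevalX cE.
by rewrite (bigD1 (Ordinal n_gt0)) //= big_set0 mul0r mulr0.
Qed.

Lemma polar_sum_diag W (u : 'I_m -> R) : (0 < n)%N ->
  W \is mpoly.ishomog1 n mpoly.mdeg ->
  @polar_sum R n m W (fun=> u) = n`!%:R * mpoly.meval u W.
Proof.
move=> n_gt0 /mpoly.dhomogP hW; rewrite polar_sum_monomials.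
rewrite [X in mpoly.meval _ X]mpoly.mpolyE raddf_sum big_distrr /=.
apply: eq_big_seq => mm /hW hm; rewrite mpoly.mevalZ mulrCA; congr (_ * _).
have [c [cE ->]] := polar_sum_monomialE n_gt0 hm.
rewrite /= sumr_const cE mulr_natl; congr (_ *+ _).
rewrite -[X in _ = X`!](card_ord n) -[in RHS]ffactnn.
rewrite -[in RHS](card_inj_ffuns 'I_n 'I_n) cardsE.
by apply: eq_card.
Qed.

(** In every product of Ryser's expansion the argument with index j0 occurs in
exactly one factor. *)
Lemma polar_sum_linear W w j0 (u : 'I_m -> R) : (0 < n)%N ->
  W \is mpoly.ishomog1 n mpoly.mdeg ->
  polar_sum W (set_arg j0 w u) =
  \sum_c u c * polar_sum W (set_arg j0 w (fun c' => (c' == c)%:R)).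
Proof.
move=> n_gt0 /mpoly.dhomogP hW; rewrite polar_sum_monomials.
under [RHS]eq_bigr do rewrite polar_sum_monomials big_distrr /=.
rewrite exchange_big /=; apply: eq_big_seq => mm /hW hm.
have [c [_ cE]] := polar_sum_monomialE n_gt0 hm.
under [RHS]eq_bigr do rewrite mulrCA.
rewrite -big_distrr /=; congr (_ * _).
under [RHS]eq_bigr do rewrite cE big_distrr /=.
rewrite cE exchange_big /=; apply: eq_bigr => f /injectiveP fi.
have [f' _ fK] := injF_bij fi.
have split_at v : \prod_l set_arg j0 w v (f l) (c l)
    = v (c (f' j0)) * \prod_(l | l != f' j0) w (f l) (c l).
  rewrite (bigD1 (f' j0)) //= {1}/set_arg fK eqxx; congr (_ * _).
  apply: eq_bigr => l lj; rewrite /set_arg ifN //.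
  by apply: contra_neq lj => <-; apply: fi; rewrite fK.
under [RHS]eq_bigr do rewrite split_at mulrA.
rewrite split_at -big_distrl /=; congr (_ * _).
rewrite (bigD1 (c (f' j0))) //= eqxx mulr1 big1 ?addr0 // => i ic.
by rewrite eq_sym (negbTE ic) mulr0.
Qed.
End PolarSum.

Lemma dhomog_mderiv (R : comRingType) (m D : nat) (i : 'I_m)
    (W : mpoly.mpoly m R) :
  W \is mpoly.ishomog1 D.+1 mpoly.mdeg ->
  mpoly.mderiv i W \is mpoly.ishomog1 D mpoly.mdeg.
Proof.
move=> /mpoly.dhomogP hW; apply/mpoly.dhomogP => mm.
rewrite mpoly.mcoeff_msupp mpoly.mcoeff_mderiv => nz.
have /hW : mpoly.mnm_add mm (mpoly.mnm1 i) \in mpoly.msupp W.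
  by rewrite mpoly.mcoeff_msupp; apply: contra_neq nz => ->; rewrite mul0rn.
by rewrite /= mpoly.mdegD mpoly.mdeg1 addn1 => -[].
Qed.

(** The polarized gradient is the polarization of the partial derivatives of the
homogenized polynomial, at the points (1, v_j).  Its properties below are those
of a symmetric multilinear form, restricted to the affine hyperplane where the
first coordinate is 1. *)
Section GradKAlgebra.
Variables (R : realType) (d k : nat) (U : mpoly.mpoly d R).
Hypothesis hU : (mpoly.msize U <= k.+3)%N.
Implicit Types v : 'I_k.+1 -> 'cV[R]_d.

Let W (i : 'I_d) := mpoly.mderiv (lift ord0 i) (homogenize k.+2 U).

Let W_homog i : W i \is mpoly.ishomog1 k.+1 mpoly.mdeg.
Proof. exact/dhomog_mderiv/homogenize_dhomog. Qed.

Lemma gradK_polar_sum v i : gradK U v i ord0 =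
  polar_sum (W i) (fun j => cons_point 1 (v j)) / k.+1`!%:R.
Proof.
rewrite summxE /polar_sum big_distrl /=; apply: eq_bigr => S _.
rewrite !mxE mulrAC; congr (_ * _ * _).
apply: mpoly.meval_eq => c; rewrite /cons_point.
case: (unliftP ord0 c) => [j|] _; first by rewrite summxE.
by rewrite sumr_const.
Qed.

Lemma gradK_diag (x : 'cV[R]_d) : gradK U (fun _ : 'I_k.+1 => x) = mgrad U x.
Proof.
apply/colP => i; rewrite gradK_polar_sum polar_sum_diag // mulrAC.
rewrite divff ?mul1r; last first.
  by rewrite pnatr_eq0 -lt0n fact_gt0.
rewrite mxE /W /homogenize [in RHS](mpoly.mpolyE U).
rewrite (linear_sum (mpoly.mderiv (lift ord0 i))) (linear_sum (mpoly.mderiv i)).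
rewrite !raddf_sum /=; apply: eq_bigr => m _.
rewrite !mpoly.mderivZ !mpoly.mevalZ !mpoly.mderivX !mpoly.mevalZ.
rewrite mpoly.mnmE liftK !mpoly.mevalX big_ord_recl {1}/cons_point unlift_none.
rewrite expr1n mul1r; congr (_ * (_ * _)); apply: eq_bigr => j _.
rewrite !mpoly.mnmBE !mpoly.mnm1E mpoly.mnmE liftK (inj_eq lift_inj).
by rewrite /cons_point liftK.
Qed.

(** The linear part of the polarized gradient as a function of its last argument;
it depends on the other arguments only. *)
Definition gradK_lin v : 'M[R]_d :=
  \matrix_(i, j) (gradK U (set_arg ord_max v (delta_mx j ord0))
                  - gradK U (set_arg ord_max v 0)) i ord0.

Lemma gradK_affine v (z z' : 'cV[R]_d) :
  gradK U (set_arg ord_max v z) - gradK U (set_arg ord_max v z')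
  = gradK_lin v *m (z - z').
Proof.
pose w j := cons_point 1 (v j).
pose P i c := polar_sum (W i) (set_arg ord_max w (fun c' => (c' == c)%:R))
  / k.+1`!%:R.
have gE i z0 : gradK U (set_arg ord_max v z0) i ord0
    = P i ord0 + \sum_j z0 j ord0 * P i (lift ord0 j).
  rewrite gradK_polar_sum.
  have -> : (fun j => cons_point 1 (set_arg ord_max v z0 j))
      = set_arg ord_max w (cons_point 1 z0).
    by apply/funext => j; rewrite /set_arg; case: ifP.
  rewrite polar_sum_linear // big_ord_recl mulrDl big_distrl /=; congr (_ + _).
    by rewrite {1}/cons_point unlift_none mul1r.
  by apply: eq_bigr => j _; rewrite {1}/cons_point liftK mulrA.
have LE i j : gradK_lin v i j = P i (lift ord0 j).
  rewrite mxE mxE [X in _ + X]mxE !gE [X in _ - (_ + X)]big1 => [|l _]; last first.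
    by rewrite mxE mul0r.
  rewrite (bigD1 j) //= mxE !eqxx mul1r big1 => [|l lj].
    by rewrite !addr0 [X in X - _]addrC addrK.
  by rewrite mxE (negbTE lj) mul0r.
apply/colP => i; rewrite mxE [X in _ + X]mxE !gE mxE.
under [RHS]eq_bigr do rewrite LE !mxE mulrBr ![P _ _ * _]mulrC.
by rewrite sumrB opprD addrACA subrr add0r.
Qed.

(** The sums over S and over its image under reversal are the same sum. *)
Lemma gradK_rev v : gradK U (fun j => v (rev_ord j)) = gradK U v.
Proof.
rewrite /gradK (reindex_inj (imset_inj (can_inj (@rev_ordK k.+1)))) /=.
apply: eq_big => [S|S _]; first by rewrite imset_eq0.
rewrite card_imset; last exact: rev_ord_inj.
congr (_ *: mgrad_x _ _ _); rewrite big_imset /=; last first.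
  by move=> a b _ _; apply: rev_ord_inj.
by apply: eq_bigr => j _; rewrite rev_ordK.
Qed.
End GradKAlgebra.

(** * Matrix norms and equivalence of norms *)

Section MatrixNorm.
Variable R : realType.

Lemma mx_norm_le m n (A : 'M[R]_(m, n)) (c : R) : 0 <= c ->
  (forall i j, `|A i j| <= c) -> `|A| <= c.
Proof.
by move=> c0 Ac; rewrite /Num.Def.normr/= mx_normrE (bigmax_le _ c0).
Qed.

Lemma le_mx_norm m n (A : 'M[R]_(m, n)) i j : `|A i j| <= `|A|.
Proof.
rewrite [leRHS]/Num.Def.normr/= mx_normrE.
exact: (le_bigmax _ (fun ij => `|A ij.1 ij.2|) (i, j)).
Qed.

Lemma mulmx_norm m n p (A : 'M[R]_(m, n)) (B : 'M[R]_(n, p)) :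
  `|A *m B| <= n%:R * `|A| * `|B|.
Proof.
apply: mx_norm_le => [|i j]; first by rewrite !mulr_ge0.
rewrite mxE (le_trans (ler_norm_sum _ _ _)) //.
rewrite -[X in X%:R * _ * _](card_ord n) -mulrA mulr_natl -sumr_const.
by apply: ler_sum => l _; rewrite normrM ler_pM // le_mx_norm.
Qed.
End MatrixNorm.

Lemma mx_norm_tr (R : realType) m n (A : 'M[R]_(m, n)) : `|A^T| = `|A|.
Proof.
have le p q (B : 'M[R]_(p, q)) : `|B^T| <= `|B|.
  by apply: mx_norm_le => // i j; rewrite mxE le_mx_norm.
by apply/eqP; rewrite eq_le le -[X in `|X| <= _](trmxK A) le.
Qed.

Section NormEquivalence.
Variables (R : realType) (d : nat) (nrm : 'cV[R]_d -> R).
Hypothesis hnrm : vector_norm nrm.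

Lemma vector_norm0 : nrm 0 = 0.
Proof.
by case: hnrm => _ _ hZ _; rewrite -(scale0r 0) hZ normr0 mul0r.
Qed.

Lemma vector_norm_le_sup : exists2 c : R, 0 < c & forall v, nrm v <= c * `|v|.
Proof.
case: hnrm => h0 _ hZ hD.
have S0 : 0 <= \sum_i nrm (delta_mx i ord0) by exact: sumr_ge0.
exists (1 + \sum_i nrm (delta_mx i ord0)) => [|v]; first by lra.
have vE : v = \sum_i v i ord0 *: delta_mx i ord0.
  rewrite {1}(matrix_sum_delta v); apply: eq_bigr => i _.
  by rewrite big_ord1.
rewrite {1}vE (@le_trans _ _ (\sum_i nrm (v i ord0 *: delta_mx i ord0))) //.
  elim/big_rec2 : _ => [|i y1 y2 _ le]; first by rewrite vector_norm0.
  by rewrite (le_trans (hD _ _)) // lerD2l.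
rewrite mulrDl mul1r big_distrl /= -[leLHS]add0r lerD // ler_sum // => i _.
by rewrite hZ mulrC ler_wpM2l // le_mx_norm.
Qed.

(** By the other inequality the given norm is continuous for the sup norm, so it
attains a minimum on the compact unit sphere of the sup norm, which is positive. *)
Lemma sup_le_vector_norm : exists2 c : R, 0 < c & forall v, `|v| <= c * nrm v.
Proof.
case: hnrm => h0 hdef hZ hD; have [c c0 hc] := vector_norm_le_sup.
pose f (u : 'rV[R]_d) := nrm u^T.
have f_lip u v : `|f u - f v| <= c * `|u - v|.
  have le a b : f a - f b <= c * `|a - b|.
    rewrite lerBlDl -mx_norm_tr (le_trans _ (lerD (lexx _) (hc _))) //.
    by rewrite (le_trans _ (hD _ _)) // linearB /= addrC subrK.
  by rewrite ler_norml -lerN2 opprK opprB le -normrN opprB le.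
pose A : set 'rV[R]_d := [set u | `|u| = 1].
have [[u0 Au0]|A0] := pselect (A !=set0); last first.
  exists 1 => // v; have [->|v0] := eqVneq v 0.
    by rewrite normr0 vector_norm0 mulr0.
  exfalso; apply: A0; exists (`|v^T|^-1 *: v^T); rewrite /A /=.
  rewrite normrZ normfV normr_id mulVf // normr_eq0.
  by apply: contra_neq v0 => /(congr1 trmx); rewrite trmxK trmx0.
have cA : compact A.
  apply: bounded_closed_compact.
    by exists 1; split => // M M1 u /= ->; exact: ltW.
  have -> : A = Num.norm @^-1` [set 1 : R] by [].
  apply: closed_comp; last exact: closed_eq.
  by move=> u _; exact: norm_continuous.
have fc : continuous f.
  move=> u; apply/(@cvgrPdist_le _ R^o _ (nbhs u)) => e e0.
  have ec : 0 < e / c by exact: divr_gt0.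
  apply: filterS (nbhsx_ballx u _ ec) => w.
  rewrite -ball_normE /= => uw.
  by rewrite (le_trans (f_lip _ _)) // mulrC -ler_pdivlMr // ltW.
have [w wA wmin] := @EVT_min_rV _ _ f A (ex_intro _ u0 Au0) cA
  (continuous_subspaceT fc).
have fw : 0 < f w.
  rewrite lt_def h0 andbT; apply/eqP => /hdef /(congr1 trmx).
  rewrite trmxK trmx0 => w0; move: wA; rewrite inE /A /= w0 normr0 => /esym/eqP.
  by rewrite oner_eq0.
exists (f w)^-1 => [|v]; first by rewrite invr_gt0.
have [->|v0] := eqVneq v 0; first by rewrite normr0 vector_norm0 mulr0.
have vT : `|v| = `|v^T|.
  by rewrite mx_norm_tr.
have vT0 : 0 < `|v^T| by rewrite -vT normr_gt0.
rewrite mulrC ler_pdivlMr // mulrC -ler_pdivlMr ?normr_gt0 // vT.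
have -> : nrm v / `|v^T| = f (`|v^T|^-1 *: v^T).
  by rewrite /f linearZ /= trmxK hZ normfV normr_id mulrC.
apply: wmin; rewrite inE /A /= normrZ normfV normr_id mulVf //.
by rewrite gt_eqF.
Qed.
End NormEquivalence.

(** * First and second differences of polynomial maps *)

(** A quantitative C^2 property without derivatives.  It is stable under sums and
products, hence holds for all polynomial maps, and it gives the O(r^2) terms of
the error analysis. *)
Definition quad_regular (R : realType) (d m : nat)
    (F : ('I_m -> 'cV[R]_d) -> R) : Prop :=
  forall B : R, 0 <= B -> exists2 K : R, 0 <= K & forall v e (r : R),
    (forall j, `|v j| <= B) -> (forall j, `|e j| <= r) -> 0 <= r <= B ->
    [/\ `|F v| <= K, `|F (fun j => v j + e j) - F v| <= K * r
      & `|F (fun j => v j + e j) + F (fun j => v j - e j) - 2 * F v|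
          <= K * r ^+ 2].

Section QuadRegular.
Variables (R : realType) (d m : nat).
Implicit Types F G : ('I_m -> 'cV[R]_d) -> R.

Lemma quad_regular_cst (c : R) : quad_regular (fun _ : 'I_m -> 'cV[R]_d => c).
Proof.
move=> B B0; exists `|c| => // v e r _ _ /andP[r0 _]; split=> //.
  by rewrite subrr normr0 mulr_ge0.
by rewrite [X in `|X|](_ : _ = 0) ?normr0 ?mulr_ge0 ?sqr_ge0 //; ring.
Qed.

Lemma quad_regular_coord j i :
  quad_regular (fun v : 'I_m -> 'cV[R]_d => v j i ord0).
Proof.
move=> B B0; exists (B + 1) => [|v e r vB er /andP[r0 rB]]; first by lra.
have vj := le_trans (le_mx_norm (v j) i ord0) (vB j).
have ej := le_trans (le_mx_norm (e j) i ord0) (er j).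
rewrite !mxE; split; first by lra.
  rewrite addrAC subrr add0r (le_trans ej) // mulrDl mul1r lerDr.
  exact: mulr_ge0.
rewrite [X in `|X|](_ : _ = 0) ?normr0 ?mulr_ge0 ?sqr_ge0 //; first by lra.
by ring.
Qed.

Lemma quad_regular_ext F G : F =1 G -> quad_regular F -> quad_regular G.
Proof. by move=> /funext ->. Qed.

Lemma quad_regularD F G : quad_regular F -> quad_regular G ->
  quad_regular (fun v => F v + G v).
Proof.
move=> hF hG B B0; have [K K0 hK] := hF B B0; have [L L0 hL] := hG B B0.
exists (K + L) => [|v e r vB er rB]; first exact: addr_ge0.
have [F0 F1 F2] := hK v e r vB er rB; have [G0 G1 G2] := hL v e r vB er rB.
rewrite !mulrDl; split.
- by rewrite (le_trans (ler_normD _ _)) // lerD.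
- rewrite opprD addrACA; by rewrite (le_trans (ler_normD _ _)) // lerD.
- rewrite [X in `|X|](_ : _ =
    (F (fun j => v j + e j) + F (fun j => v j - e j) - 2 * F v)
    + (G (fun j => v j + e j) + G (fun j => v j - e j) - 2 * G v)); last by ring.
  by rewrite (le_trans (ler_normD _ _)) // lerD.
Qed.

Lemma quad_regularM F G : quad_regular F -> quad_regular G ->
  quad_regular (fun v => F v * G v).
Proof.
move=> hF hG B B0; have [K K0 hK] := hF B B0; have [L L0 hL] := hG B B0.
have KL0 : 0 <= K * L by exact: mulr_ge0.
exists (K * L * (B + 4)) => [|v e r vB er rB]; first by rewrite mulr_ge0 //; lra.
have eNr j : `|- e j| <= r by rewrite normrN.
have [F0 F1 F2] := hK v e r vB er rB; have [G0 G1 G2] := hL v e r vB er rB.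
have [_ F1N _] := hK v (fun j => - e j) r vB eNr rB.
have [_ G1N _] := hL v (fun j => - e j) r vB eNr rB.
move: rB => /andP[r0 rB].
move: F0 F1 F2 F1N G0 G1 G2 G1N.
set fp := F (fun j => v j + e j); set fm := F (fun j => v j - e j).
set gp := G (fun j => v j + e j); set gm := G (fun j => v j - e j).
move: (F v) (G v) => f g F0 F1 F2 F1N G0 G1 G2 G1N.
split.
- rewrite normrM (le_trans (ler_pM _ _ F0 G0)) // ler_peMr //; lra.
- rewrite (_ : _ - _ = f * (gp - g) + g * (fp - f) + (fp - f) * (gp - g));
    last by ring.
  rewrite (le_trans (ler_normD _ _)) // (_ : K * L * (B + 4) * r =
    K * (L * r) + L * (K * r) + (K * r) * (L * B) + 2 * (K * L * r));
    last by ring.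
  rewrite -[leLHS]addr0 lerD ?mulr_ge0 //.
  rewrite lerD // ?(le_trans (ler_normD _ _)) // ?lerD // normrM ler_pM //.
  by rewrite (le_trans G1) // ler_wpM2l.
- rewrite (_ : _ - _ = f * (gp + gm - 2 * g) + g * (fp + fm - 2 * f)
    + (fp - f) * (gp - g) + (fm - f) * (gm - g)); last by ring.
  rewrite (_ : K * L * (B + 4) * r ^+ 2 = K * (L * r ^+ 2) + L * (K * r ^+ 2)
    + (K * r) * (L * r) + (K * r) * (L * r) + B * (K * L * r ^+ 2)); last by ring.
  rewrite -[leLHS]addr0 lerD ?mulr_ge0 ?sqr_ge0 //.
  do 3?[rewrite (le_trans (ler_normD _ _)) // lerD //]; by rewrite normrM ler_pM.
Qed.

Lemma quad_regular_sum (I : Type) (s : seq I) (P : pred I)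
    (F : I -> ('I_m -> 'cV[R]_d) -> R) :
  (forall i, P i -> quad_regular (F i)) ->
  quad_regular (fun v => \sum_(i <- s | P i) F i v).
Proof.
move=> hF; elim: s => [|i s IH].
  by apply: (quad_regular_ext _ (quad_regular_cst 0)) => v; rewrite big_nil.
case Pi: (P i); last first.
  by apply: (quad_regular_ext _ IH) => v; rewrite big_cons Pi.
apply: (quad_regular_ext _ (quad_regularD (hF i Pi) IH)) => v.
by rewrite big_cons Pi.
Qed.

Lemma quad_regular_prod (I : Type) (s : seq I) (P : pred I)
    (F : I -> ('I_m -> 'cV[R]_d) -> R) :
  (forall i, P i -> quad_regular (F i)) ->
  quad_regular (fun v => \prod_(i <- s | P i) F i v).
Proof.
move=> hF; elim: s => [|i s IH].
  by apply: (quad_regular_ext _ (quad_regular_cst 1)) => v; rewrite big_nil.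
case Pi: (P i); last first.
  by apply: (quad_regular_ext _ IH) => v; rewrite big_cons Pi.
apply: (quad_regular_ext _ (quad_regularM (hF i Pi) IH)) => v.
by rewrite big_cons Pi.
Qed.

Lemma quad_regular_meval p (W : mpoly.mpoly p R)
    (g : 'I_p -> ('I_m -> 'cV[R]_d) -> R) :
  (forall c, quad_regular (g c)) ->
  quad_regular (fun v => mpoly.meval (fun c => g c v) W).
Proof.
move=> hg.
apply: (@quad_regular_ext (fun v => \sum_(mm <- mpoly.msupp W)
  mpoly.mcoeff mm W * \prod_c g c v ^+ mm c)) => [v|].
  by rewrite mpoly.mevalE.
apply: quad_regular_sum => mm _; apply: quad_regularM.
  exact: quad_regular_cst.
apply: quad_regular_prod => c _; elim: (mm c) => [|n IH].
  exact: quad_regular_cst.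
apply: (quad_regular_ext _ (quad_regularM (hg c) IH)) => v.
by rewrite exprS.
Qed.
End QuadRegular.

Lemma quad_regular_gradK (R : realType) (d k : nat) (U : mpoly.mpoly d R) i :
  quad_regular (fun v : 'I_k.+1 -> 'cV[R]_d => gradK U v i ord0).
Proof.
pose w (S : {set 'I_k.+1}) (c : 'I_d.+1) (v : 'I_k.+1 -> 'cV[R]_d) :=
  cons_point #|S|%:R (\sum_(j in S) v j) c.
apply: (@quad_regular_ext _ _ _ (fun v => \sum_(S | S != finset.set0)
    ((-1) ^+ (k.+1 - #|S|) / k.+1`!%:R) *
    mpoly.meval (w S ^~ v)
      (mpoly.mderiv (lift ord0 i) (homogenize k.+2 U)))) => [v|].
  by rewrite summxE; apply: eq_bigr => S _; rewrite !mxE.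
apply: quad_regular_sum => S _; apply: quad_regularM.
  exact: quad_regular_cst.
apply: quad_regular_meval => c.
rewrite /w /cons_point; case: (unliftP ord0 c) => [l|] _.
  apply: (@quad_regular_ext _ _ _ (fun v => \sum_(j in S) v j l ord0)) => [v|].
    by rewrite summxE.
  by apply: quad_regular_sum => j _; apply: quad_regular_coord.
exact: quad_regular_cst.
Qed.

Definition gradK_regular (R : realType) (d k : nat) (B K : R)
    (U : mpoly.mpoly d R) : Prop :=
  forall (v e : 'I_k.+1 -> 'cV[R]_d) (r : R),
    (forall j, `|v j| <= B) -> (forall j, `|e j| <= r) -> 0 <= r <= B ->
    [/\ `|gradK U v| <= K, `|gradK U (fun j => v j + e j) - gradK U v| <= K * r
      & `|gradK U (fun j => v j + e j) + gradK U (fun j => v j - e j)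
          - gradK U v *+ 2| <= K * r ^+ 2].

Lemma gradK_quad_regular (R : realType) (d k : nat) (U : mpoly.mpoly d R)
    (B : R) : 0 <= B -> exists2 K : R, 0 <= K & gradK_regular k B K U.
Proof.
move=> B0.
have /choice[K /all_and2[K0 hK]] : forall i : 'I_d, exists K : R, 0 <= K /\
    forall v e (r : R),
    (forall j : 'I_k.+1, `|v j| <= B) -> (forall j, `|e j| <= r) -> 0 <= r <= B ->
    [/\ `|gradK U v i ord0| <= K,
      `|gradK U (fun j => v j + e j) i ord0 - gradK U v i ord0| <= K * r
      & `|gradK U (fun j => v j + e j) i ord0
          + gradK U (fun j => v j - e j) i ord0 - 2 * gradK U v i ord0|
          <= K * r ^+ 2].
  by move=> i; have [K K0 hK] := @quad_regular_gradK R d k U i B B0; exists K.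
have K_le i : K i <= \sum_i K i.
  by rewrite (bigD1 i) //= lerDl sumr_ge0.
have S0 : 0 <= \sum_i K i by exact: sumr_ge0.
exists (\sum_i K i) => // v e r vB er rB; have /andP[r0 _] := rB.
split; (apply: mx_norm_le => [|i j]; first by rewrite ?mulr_ge0 ?sqr_ge0);
  rewrite ord1; have [h1 h2 h3] := hK i v e r vB er rB.
- exact: le_trans h1 _.
- by rewrite !mxE (le_trans h2) // ler_wpM2r.
- rewrite mulr2n !mxE -mulr2n -mulr_natl (le_trans h3) // ler_wpM2r ?sqr_ge0 //.
Qed.

(** * The exponential and phi of a small matrix *)

(* Joins completeness and the norm, so that absolutely convergent series of
   matrices converge. *)
HB.instance Definition _ (R : realType) m n := Complete.on 'M[R]_(m, n).

Lemma mx_pow_norm (R : realType) (d : nat) (Z : 'M[R]_d) l :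
  `|Z ^+ l| <= (d%:R * `|Z|) ^+ l.
Proof.
elim: l => [|l IH].
  rewrite !expr0; apply: mx_norm_le => // i j.
  by rewrite mxE; case: (i == j); rewrite ?normr1 ?normr0.
rewrite !exprS (le_trans (mulmx_norm _ _)) // ler_wpM2l //.
Qed.

(** For the small matrices kh A only the bound 1 on the coefficients matters:
the series is dominated by a geometric series of ratio at most 1/2, since d times
the sup norm is submultiplicative. *)
Section PowerSeries.
Variables (R : realType) (d : nat) (c : nat -> R) (Z : 'M[R]_d).
Hypothesis hc : forall l, `|c l| <= 1.
Hypothesis hZ : d%:R * `|Z| <= 1 / 2.

Let u l := c l *: Z ^+ l.
Let z := d%:R * `|Z|.

Let z0 : 0 <= z. Proof. exact: mulr_ge0. Qed.
Let u_le l : `|u l| <= z ^+ l.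
Proof.
by rewrite normrZ -[leRHS]mul1r ler_pM // mx_pow_norm.
Qed.

Lemma mx_pseries_cvg : series u @ \oo --> mx_pseries c Z.
Proof.
suff : cvgn (series u) by [].
apply: normed_cvg; apply: (@series_le_cvg _ _ (geometric 1 z)) => [l|l|l|] /=.
- exact: normr_ge0.
- by rewrite mul1r exprn_ge0.
- by rewrite mul1r.
- apply: is_cvg_geometric_series; rewrite ger0_norm //.
  by rewrite (le_lt_trans hZ) //; lra.
Qed.

Lemma mx_pseries_tail p :
  `|mx_pseries c Z - series u p| <= 2 * z ^+ p.
Proof.
have part q : `|series u (p + q)%N - series u p| <= 2 * z ^+ p * (1 - (1/2) ^+ q).
  elim: q => [|q IH].
    by rewrite addn0 subrr normr0 expr0 subrr mulr0.
  have -> : series u (p + q.+1)%N = series u (p + q)%N + u (p + q)%N.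
    by rewrite addnS /series /= big_nat_recr.
  rewrite addrAC (le_trans (ler_normD _ _)) //.
  rewrite (le_trans (lerD IH (u_le _))) // exprD.
  have : z ^+ p * z ^+ q <= z ^+ p * (1 / 2) ^+ q.
    by rewrite ler_wpM2l ?exprn_ge0 // lerXn2r ?nnegrE //; lra.
  rewrite exprS; lra.
apply/ler_addgt0Pr => e e0.
have [q _ hq] := (cvgrPdist_le _ _).1 mx_pseries_cvg e e0.
have {hq} := hq (p + q)%N; rewrite /= leq_addl => /(_ isT) hq.
rewrite -(subrKA (series u (p + q)%N)) (le_trans (ler_normD _ _)) // addrC.
rewrite lerD // (le_trans (part q)) // ler_piMr ?mulr_ge0 ?exprn_ge0 //.
Qed.

Lemma mx_pseries_norm : `|mx_pseries c Z| <= 2.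
Proof.
have := mx_pseries_tail 0.
by rewrite /series /= big_geq // subr0 expr0 mulr1.
Qed.
End PowerSeries.

Section ExpPhi.
Variables (R : realType) (d : nat) (Z : 'M[R]_d).
Hypothesis hZ : d%:R * `|Z| <= 1 / 2.

Let inv_fact_le1 l : `|(l`!%:R)^-1 : R| <= 1.
Proof.
by rewrite ger0_norm ?invr_ge0 // invf_le1 ?ltr0n ?ler1n ?fact_gt0.
Qed.

Lemma phimx_norm : `|phimx Z| <= 2.
Proof. exact: mx_pseries_norm. Qed.

Lemma phimx_expansion :
  `|phimx Z - (1 + (1 / 2) *: Z)| <= 2 * (d%:R * `|Z|) ^+ 2.
Proof.
have := mx_pseries_tail (fun l => inv_fact_le1 l.+1) hZ 2.
rewrite /series /= big_nat_recr // big_nat1 /=.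
by rewrite expr0 expr1 (_ : 2`! = 2%N) // (_ : 1`! = 1%N) // invr1 scale1r mul1r.
Qed.

Lemma expmx_phimx : expmx Z = 1%:M + Z *m phimx Z.
Proof.
have ce := mx_pseries_cvg inv_fact_le1 hZ.
have cp := mx_pseries_cvg (fun l => inv_fact_le1 l.+1) hZ.
suff : [sequence series (fun l => (l`!%:R)^-1 *: Z ^+ l) (n + 1)%N]_n @ \oo
    --> 1 + Z * phimx Z.
  by rewrite cvg_shiftn; apply: cvg_unique.
apply/cvgrPdist_le => e e0.
have dZ0 : 0 < d%:R * `|Z| + 1 :> R by rewrite ltr_wpDl ?mulr_ge0.
have e'0 : 0 < e / (d%:R * `|Z| + 1) by exact: divr_gt0.
have [q _ hq] := (cvgrPdist_le _ _).1 cp _ e'0.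
exists q => // n qn /=; have {hq} := hq n qn.
rewrite ler_pdivlMr // addn1 => hq.
rewrite /series /= big_nat_recl //= fact0 invr1 expr0 scale1r.
rewrite opprD addrACA subrr add0r.
rewrite (_ : \sum_(0 <= i < n) _ = Z * series
  (fun l => (l.+1`!%:R)^-1 *: Z ^+ l) n); last first.
  rewrite /series /= big_distrr; apply: eq_bigr => l _ /=.
  by rewrite exprS; exact: scalemxAr.
rewrite -mulrBr (le_trans (mulmx_norm _ _)) // (le_trans _ hq) //.
by rewrite mulrC ler_wpM2l // lerDl.
Qed.
End ExpPhi.

(** * A mean value inequality for curves *)

(** Differentiability on a closed interval, one-sided at the end points, in the
form that passes to restrictions, reflections and differences of curves. *)
Definition has_deriv_on (R : realType) (V : normedModType R) (a b : R)
    (y dy : R -> V) : Prop :=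
  forall t, a <= t <= b -> forall e : R, 0 < e ->
  exists2 r : R, 0 < r & forall s, a <= s <= b -> `|s - t| < r ->
    `|y s - y t - (s - t) *: dy t| <= e * `|s - t|.

Section MeanValue.
Variable R : realType.

Lemma has_deriv_on_continuous (a b : R) (g dg : R -> R^o) :
  has_deriv_on a b g dg -> {within `[a, b], continuous g}.
Proof.
move=> hg; apply/subspace_continuousP => t; rewrite /= in_itv /= => tab.
apply/cvgrPdist_le => e e0.
have [r r0 hr] := hg t tab 1 ltr01.
have c0 : 0 < 1 + `|dg t| by rewrite ltr_wpDr.
have m0 : 0 < Num.min r (e / (1 + `|dg t|)) by rewrite lt_min r0 divr_gt0.
rewrite near_withinE; near=> s => /=; rewrite in_itv /= => sab.
have st : `|s - t| < Num.min r (e / (1 + `|dg t|)).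
  by near: s; apply: filterS (nbhsx_ballx t _ m0) => s; rewrite /ball /= distrC.
move: st; rewrite lt_min ltr_pdivlMr // => /andP[sr se].
rewrite distrC -[g s - g t](subrK ((s - t) *: dg t)).
rewrite (le_trans (ler_normD _ _)) // (le_trans _ (ltW se)) //.
rewrite mulrDr mulr1 lerD //; last by rewrite normrM.
by rewrite (le_trans (hr _ _ _)) // mul1r.
Unshelve. all: by end_near. Qed.

Lemma has_deriv_on_is_derive (a b : R) (g dg : R -> R^o) t :
  has_deriv_on a b g dg -> a < t < b -> is_derive t (1 : R) g (dg t).
Proof.
move=> hg /andP[at_ tb].
have cv : (fun h => h^-1 *: ((g \o shift t) (h *: (1 : R)) - g t)) @ 0^' --> dg t.
  apply/cvgrPdist_le => e e0.
  have [|r r0 hr] := hg t _ e e0; first by rewrite !ltW.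
  near=> h.
  have h0 : h != 0 by near: h; exact: nbhs_dnbhs_neq.
  have hlt : `|h| < Num.min r (Num.min (t - a) (b - t)).
    by near: h; apply: dnbhs0_lt; rewrite !lt_min r0 !subr_gt0 at_.
  move: hlt; rewrite !lt_min => /and3P[hr1 ha hb].
  have := hr (h + t); rewrite addrK /= => /(_ _ hr1) H.
  rewrite [h *: _]mulr1 distrC.
  have hn : 0 < `|h| by rewrite normr_gt0.
  have E (p q : R^o) : (h^-1 *: p - q) * h = p - h *: q.
    by rewrite /GRing.scale /=; field.
  rewrite -(ler_pM2r hn) -normrM E H //.
  by move: ha hb; rewrite !ltr_norml => /andP[? ?] /andP[? ?]; lra.
by apply: DeriveDef; [apply/cvg_ex; exists (dg t) | apply/cvg_lim].
Unshelve. all: by end_near. Qed.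

(** The mean value theorem, applied to each coordinate; the sup norm avoids any
loss in the constant. *)
Lemma mean_value_bound (d : nat) (a b K : R) (y dy : R -> 'cV[R]_d) :
  a <= b -> 0 <= K -> has_deriv_on a b y dy ->
  (forall t, a <= t <= b -> `|dy t| <= K) ->
  `|y b - y a| <= K * (b - a).
Proof.
move=> ab K0 hy hK; apply: mx_norm_le => [|i j].
  by rewrite mulr_ge0 // subr_ge0.
have hyi : has_deriv_on a b (fun t => y t i j : R^o) (fun t => dy t i j).
  move=> t tab e e0; have [r r0 hr] := hy t tab e e0.
  exists r => // s sab sr; apply: le_trans (hr s sab sr).
  by have := le_mx_norm (y s - y t - (s - t) *: dy t) i j; rewrite !mxE.
have hd t : t \in `]a, b[%R -> is_derive t (1 : R) (fun t => y t i j) (dy t i j).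
  by rewrite in_itv /=; apply: has_deriv_on_is_derive hyi.
have [c cab E] := MVT_segment ab hd (has_deriv_on_continuous hyi).
rewrite !mxE E normrM (ger0_norm (_ : 0 <= b - a)) ?subr_ge0 //.
rewrite ler_wpM2r ?subr_ge0 // (le_trans (le_mx_norm _ _ _)) // hK //.
Qed.

Lemma solves_ode_has_deriv (d : nat) (f : 'cV[R]_d -> 'cV[R]_d) (T : R)
    (x : R -> 'cV[R]_d) :
  solves_ode f T x -> has_deriv_on 0 T x (fun t => f (x t)).
Proof.
move=> hx t tT e e0; have := hx t; rewrite in_itv /= => /(_ tT).
move=> /cvgrPdist_le /(_ e e0); rewrite near_withinE.
move=> /nbhs_ballP [r /= r0 hr]; exists r => // s sT sr.
have [->|st] := eqVneq s t; first by rewrite !subrr scale0r subr0 !normr0 mulr0.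
have st0 : s - t != 0 by rewrite subr_eq0.
have := hr s; rewrite /ball /= distrC => /(_ sr st); rewrite in_itv /= => /(_ sT).
rewrite -(ler_pM2r (_ : 0 < `|s - t|)) ?normr_gt0 // mulrC -normrZ scalerBr.
by rewrite scalerA divff // scale1r distrC.
Qed.
End MeanValue.

(* Identities between column vectors are checked entrywise.  Matrix products have
   to be generalized first, since they would be expanded into sums. *)
Ltac vec_ring := apply/matrixP => ? ?; rewrite ?mulr2n ?mxE; ring.
Ltac vec_field := apply/matrixP => ? ?; rewrite ?mulr2n ?mxE; field.

Lemma has_deriv_on_sub (R : realType) (V : normedModType R) (a b a' b' : R)
    (y dy : R -> V) :
  a <= a' -> b' <= b -> has_deriv_on a b y dy -> has_deriv_on a' b' y dy.
Proof.
move=> aa bb hy t /andP[t1 t2] e e0; have [|r r0 hr] := hy t _ e e0.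
  by rewrite (le_trans aa t1) (le_trans t2 bb).
exists r => // s /andP[s1 s2]; apply: hr.
by rewrite (le_trans aa s1) (le_trans s2 bb).
Qed.

Lemma has_deriv_onB_linear (R : realType) (d : nat) (a b : R)
    (y dy : R -> 'cV[R]_d) (w : 'cV[R]_d) :
  has_deriv_on a b y dy ->
  has_deriv_on a b (fun s => y s - s *: w) (fun s => dy s - w).
Proof.
move=> hy t tab e e0; have [r r0 hr] := hy t tab e e0.
exists r => // s sab sr; apply: le_trans (hr s sab sr).
by rewrite (_ : _ - _ - _ = y s - y t - (s - t) *: dy t) //; vec_ring.
Qed.

(** * Differences along the exact solution *)

Definition quad_regular_map (R : realType) (d : nat) (B K : R)
    (F : 'cV[R]_d -> 'cV[R]_d) : Prop :=
  forall v e (r : R), `|v| <= B -> `|e| <= r -> 0 <= r <= B ->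
    [/\ `|F v| <= K, `|F (v + e) - F v| <= K * r
      & `|F (v + e) + F (v - e) - F v *+ 2| <= K * r ^+ 2].

(** The curve stays in the ball of radius B / 2, so that a point of the curve
plus half the difference of two others is in the ball of radius B. *)
Section Trajectory.
Variables (R : realType) (d : nat) (F : 'cV[R]_d -> 'cV[R]_d) (T B K : R).
Variable x : R -> 'cV[R]_d.
Hypothesis hF : quad_regular_map B K F.
Hypothesis hx : has_deriv_on 0 T x (fun t => F (x t)).
Hypothesis hxB : forall t, 0 <= t <= T -> 2 * `|x t| <= B.
Hypothesis B2 : 2 <= B.
Hypothesis K1 : 1 <= K.

Let xB t : 0 <= t <= T -> `|x t| <= B.
Proof. by move=> /hxB; have := normr_ge0 (x t); lra. Qed.

Let F_lip v e r : `|v| <= B -> `|e| <= r -> 0 <= r <= B ->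
  `|F (v + e) - F v| <= K * r.
Proof. by move=> vB er rB; case: (hF vB er rB). Qed.

Let F_bound v : `|v| <= B -> `|F v| <= K.
Proof.
move=> vB; have n0 : `|0 : 'cV[R]_d| <= 0 by rewrite normr0.
have r0 : (0 : R) <= 0 <= B by rewrite lexx /=; have := B2; lra.
by have [] := hF vB n0 r0.
Qed.

Lemma trajectory_lipschitz s t : 0 <= s <= T -> 0 <= t <= T ->
  `|x s - x t| <= K * `|s - t|.
Proof.
have b2 := B2; have k1 := K1.
wlog st : s t / t <= s => [wl|] sT tT.
  have [st|/ltW st] := leP t s; first exact: wl.
  by rewrite distrC [`|s - t|]distrC; apply: wl.
have /andP[s0 s1] := sT; have /andP[t0 t1] := tT.
rewrite (ger0_norm (_ : 0 <= s - t)) ?subr_ge0 //.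
apply: (@mean_value_bound _ _ _ _ _ x (fun t => F (x t))) => //.
- lra.
- exact: has_deriv_on_sub hx.
- by move=> u /andP[u1 u2]; apply/F_bound/xB; lra.
Qed.

Lemma trajectory_first_order s t : 0 <= s <= T -> 0 <= t <= T ->
  K * `|s - t| <= 1 ->
  `|x s - x t - (s - t) *: F (x t)| <= K ^+ 2 * `|s - t| ^+ 2.
Proof.
have b2 := B2; have k1 := K1.
move=> sT tT Kst; set a := Num.min s t; set b := Num.max s t.
have [ab abE] : a <= b /\ b - a = `|s - t|.
  rewrite /a /b; case: (leP s t) => st; split; rewrite ?(ltW st) //.
    by rewrite distrC ger0_norm // subr_ge0.
  by rewrite ger0_norm // subr_ge0 ltW.
have [a0 bT] : 0 <= a /\ b <= T.
  by rewrite /a /b; case: (leP s t) => st; split; lra.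
have tab : a <= t <= b by rewrite /a /b; case: (leP s t) => st; lra.
pose y u := x u - u *: F (x t).
suff : `|y b - y a| <= K ^+ 2 * `|s - t| ^+ 2.
  rewrite /y /a /b; case: (leP s t) => st.
    rewrite distrC; congr (`|_| <= _); vec_ring.
  congr (`|_| <= _); vec_ring.
rewrite [`|s - t| ^+ 2]expr2 mulrA -{2}abE.
apply: (@mean_value_bound _ _ _ _ _ y (fun u => F (x u) - F (x t))) => //.
- by rewrite mulr_ge0 // sqr_ge0.
- exact/has_deriv_onB_linear/(has_deriv_on_sub a0 bT hx).
- move=> u uab.
  have uT : 0 <= u <= T by lra.
  have ut : `|u - t| <= `|s - t|.
    by rewrite -abE ler_norml; lra.
  have xut : `|x u - x t| <= K * `|s - t|.
    rewrite (le_trans (trajectory_lipschitz uT tT)) // ler_wpM2l //; lra.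
  have := F_lip (xB tT) xut; rewrite subrKC expr2 -mulrA; apply.
  by rewrite mulr_ge0 //=; lra.
Qed.

Lemma trajectory_symmetric_difference c r : 0 <= r -> 0 <= c - r -> c + r <= T ->
  K * r <= 1 ->
  `|x (c + r) + x (c - r) - x c *+ 2| <= 2 * K ^+ 2 * r ^+ 2.
Proof.
have b2 := B2; have k1 := K1.
move=> r0 c0 cT Kr.
have h1 := @trajectory_first_order (c + r) c.
have h2 := @trajectory_first_order (c - r) c.
have E1 : c + r - c = r by ring.
have E2 : c - r - c = - r by ring.
rewrite E1 ger0_norm // in h1; rewrite E2 normrN ger0_norm // in h2.
rewrite (_ : _ - _ = (x (c + r) - x c - r *: F (x c))
  + (x (c - r) - x c - (- r) *: F (x c))); last by vec_ring.
rewrite (le_trans (ler_normD _ _)) // -mulrA mulrDl !mul1r lerD //.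
  by apply: h1 => //; lra.
by apply: h2 => //; lra.
Qed.

(** The points x(c + r) and x(c - r) are reflections of each other about x(c) only
up to [trajectory_symmetric_difference]: compare F at x(c - r) with F at the
exact reflection of x(c + r), and apply the second difference bound there. *)
Lemma field_symmetric_difference c r : 0 <= r -> 0 <= c - r -> c + r <= T ->
  K * r <= 1 ->
  `|F (x (c + r)) + F (x (c - r)) - F (x c) *+ 2| <= 3 * K ^+ 3 * r ^+ 2.
Proof.
have b2 := B2; have k1 := K1.
move=> r0 c0 cT Kr.
have cT' : 0 <= c <= T by lra.
have cpT : 0 <= c + r <= T by lra.
have cmT : 0 <= c - r <= T by lra.
have xE : `|x (c + r) - x c| <= K * r.
  have := trajectory_lipschitz cpT cT'.
  by rewrite (_ : c + r - c = r) ?ger0_norm //; ring.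
have Kr0 : 0 <= K * r by rewrite mulr_ge0 //; lra.
have Kr2 : (K * r) ^+ 2 <= 1 by rewrite expr_le1.
have rho := trajectory_symmetric_difference r0 c0 cT Kr.
set e := x (c + r) - x c in xE.
set p := x (c + r) + x (c - r) - x c *+ 2 in rho.
have rB : 0 <= K * r <= B by lra.
have [_ _ s1] := hF (xB cT') xE rB.
have xmE : x (c - r) + - p = x c - e by rewrite /p /e; vec_ring.
have s2 : `|F (x c - e) - F (x (c - r))| <= K * (2 * K ^+ 2 * r ^+ 2).
  rewrite -xmE; apply: F_lip; rewrite ?normrN ?xB //.
  by rewrite -mulrA -exprMn mulr_ge0 ?sqr_ge0 //=; lra.
rewrite (subrKC (x c) (x (c + r))) in s1.
rewrite (_ : _ - _ = (F (x (c + r)) + F (x c - e) - F (x c) *+ 2)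
   - (F (x c - e) - F (x (c - r)))); last by vec_ring.
rewrite (le_trans (ler_normB _ _)) // (le_trans (lerD s1 s2)) //.
by rewrite le_eqVlt; apply/orP; left; apply/eqP; ring.
Qed.

(** The midpoint rule: the derivative in r of the left side is the symmetric
difference of [field_symmetric_difference]. *)
Lemma trajectory_midpoint c r : 0 <= r -> 0 <= c - r -> c + r <= T ->
  K * r <= 1 ->
  `|x (c + r) - x (c - r) - (2 * r) *: F (x c)| <= 3 * K ^+ 3 * r ^+ 3.
Proof.
have b2 := B2; have k1 := K1.
move=> r0 c0 cT Kr.
pose y u := x (c + u) - x (c - u) - u *: (F (x c) *+ 2).
have y0 : y 0 = 0 by rewrite /y addr0 subr0; vec_ring.
have -> : x (c + r) - x (c - r) - (2 * r) *: F (x c) = y r - y 0.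
  by rewrite y0 /y; vec_ring.
rewrite [r ^+ 3]exprSr mulrA -[X in _ <= _ * X](subr0 r).
have K3 : 0 <= 3 * K ^+ 3 * r ^+ 2.
  by rewrite !mulr_ge0 ?exprn_ge0 //; lra.
apply: (@mean_value_bound _ _ _ _ _ y
  (fun u => F (x (c + u)) + F (x (c - u)) - F (x c) *+ 2)) => //; last first.
  move=> u /andP[u0 ur].
  have Ku : K * u <= 1 by rewrite (le_trans _ Kr) // ler_wpM2l //; lra.
  rewrite (le_trans (@field_symmetric_difference c u u0 _ _ Ku)) //; try lra.
  by rewrite ler_wpM2l ?lerXn2r ?nnegrE // mulr_ge0 ?exprn_ge0 //; lra.
apply: (@has_deriv_onB_linear _ _ _ _ (fun u => x (c + u) - x (c - u))
  (fun u => F (x (c + u)) + F (x (c - u)))).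
move=> t /andP[t0 tr] e e0.
have e2 : 0 < e / 2 by lra.
have [|r1 r10 hr1] := @hx (c + t) _ _ e2; first by lra.
have [|r2 r20 hr2] := @hx (c - t) _ _ e2; first by lra.
exists (Num.min r1 r2) => [|s /andP[s0 sr]]; first by rewrite lt_min r10.
rewrite lt_min => /andP[st1 st2].
have E1 : c + s - (c + t) = s - t by ring.
have E2 : c - s - (c - t) = - (s - t) by ring.
have := hr1 (c + s); rewrite E1 => h1.
have := hr2 (c - s); rewrite E2 normrN => h2.
rewrite (_ : _ - _ - _ =
  (x (c + s) - x (c + t) - (s - t) *: F (x (c + t)))
  - (x (c - s) - x (c - t) - (- (s - t)) *: F (x (c - t)))); last by vec_ring.
rewrite (le_trans (ler_normB _ _)) // [e]splitr mulrDl lerD //.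
  by apply: h1 => //; lra.
by apply: h2 => //; lra.
Qed.
End Trajectory.

(** * Local error of the scheme *)

Section LocalError.
Variables (R : realType) (d k : nat) (Q A : 'M[R]_d) (U : mpoly.mpoly d R).
Variables (T B K : R) (x : R -> 'cV[R]_d).
Hypothesis hU : (mpoly.msize U <= k.+3)%N.
Let F v := A *m v + Q *m mgrad U v.
Hypothesis hG : gradK_regular k B K U.
Hypothesis hF : quad_regular_map B K F.
Hypothesis hx : has_deriv_on 0 T x (fun t => F (x t)).
Hypothesis hxB : forall t, 0 <= t <= T -> 2 * `|x t| <= B.
Hypothesis B2 : 2 <= B.
Hypothesis K1 : 1 <= K.

(** Second order consistency from symmetry.  Split x(t + j h) = x(c) + e_j + p_j
with e antisymmetric under reversal of j and p_j = O(h^2).  Then G takes the same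
value at x(c) + e and at x(c) - e, and its second difference bound gives
G(x(c) + e) = grad U(x(c)) + O(h^2). *)
Lemma gradK_consistency t h : 0 <= t -> 0 <= h -> t + k%:R * h <= T ->
  K * (k%:R * h) <= 1 ->
  `|gradK U (fun i : 'I_k.+1 => x (t + i%:R * h))
    - mgrad U (x (t + k%:R * h / 2))| <= 2 * K ^+ 3 * (k%:R * h) ^+ 2.
Proof.
have b2 := B2; have k1 := K1; have k0 : 0 <= K := le_trans ler01 k1.
move=> t0 h0 tT KH; set H := k%:R * h in KH tT *.
have H0 : 0 <= H by rewrite mulr_ge0.
set c := t + H / 2.
have cT : 0 <= c <= T by rewrite /c; lra.
have hi (i : 'I_k.+1) : 0 <= i%:R * h <= H.
  by rewrite mulr_ge0 //= ler_wpM2r // ler_nat -ltnS.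
have hr (i : 'I_k.+1) : (rev_ord i)%:R * h = H - i%:R * h.
  by rewrite /= subSS natrB ?mulrBl // -ltnS.
pose y (i : 'I_k.+1) := x (t + i%:R * h).
have yT (i : 'I_k.+1) : 0 <= t + i%:R * h <= T by have := hi i; lra.
have yB i : 2 * `|y i| <= B by exact: hxB.
(* The antisymmetric part of the window about x c, and the remainder. *)
pose e i := (1 / 2) *: (y i - y (rev_ord i)).
pose p i := (1 / 2) *: (y i + y (rev_ord i) - x c *+ 2).
have yE i : y i = (x c + e i) + p i by rewrite /e /p; vec_field.
have half_norm (v : 'cV[R]_d) : `|(1 / 2) *: v| = `|v| / 2.
  by rewrite normrZ ger0_norm; lra.
have e_small i : `|e i| <= K * H.
  rewrite half_norm ler_pdivrMr //.
  rewrite (le_trans (trajectory_lipschitz hF hx hxB B2 K1 (yT _) (yT _))) //.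
  rewrite -mulrA ler_wpM2l //.
  by rewrite hr ler_norml; have := hi i; lra.
have p_small i : `|p i| <= K ^+ 2 * H ^+ 2.
  have sym s : `|s| <= H / 2 ->
      `|x (c + s) + x (c - s) - x c *+ 2| <= 2 * (K ^+ 2 * H ^+ 2).
    wlog s0 : s / 0 <= s => [wl|] sH.
      have [/wl|/ltW s0] := leP 0 s; first exact.
      have := wl (- s); rewrite opprK oppr_ge0 normrN [x (c - s) + _]addrC.
      exact.
    move: sH; rewrite ger0_norm // => sH.
    rewrite (le_trans (trajectory_symmetric_difference hF hx hxB B2 K1 s0 _ _ _))
      /c //; try lra.
      by rewrite (le_trans _ KH) // ler_wpM2l; lra.
    rewrite mulrA ler_wpM2l ?mulr_ge0 ?sqr_ge0 //.
    by rewrite lerXn2r ?nnegrE //; lra.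
  rewrite half_norm ler_pdivrMr // mulrC.
  have := sym (i%:R * h - H / 2).
  rewrite (_ : c + _ = t + i%:R * h); last by rewrite /c; ring.
  rewrite (_ : c - _ = t + (rev_ord i)%:R * h); last by rewrite /c hr; field.
  by apply; rewrite ler_norml; have := hi i; lra.
have xcB : `|x c| <= B by have := hxB cT; have := normr_ge0 (x c); lra.
have xceB i : `|x c + e i| <= B.
  rewrite (le_trans (ler_normD _ _)) // half_norm.
  have := ler_normB (y i) (y (rev_ord i)).
  by have := hxB cT; have := yB i; have := yB (rev_ord i); lra.
have KH0 : 0 <= K * H by rewrite mulr_ge0 //; lra.
have rB : 0 <= K * H <= B by lra.
have [_ _ s1] := hG (fun=> xcB) e_small rB.
have revE : gradK U (fun j => x c - e j) = gradK U (fun j => x c + e j).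
  rewrite -gradK_rev; congr gradK; apply/funext => j.
  by rewrite /e rev_ordK; vec_ring.
rewrite revE gradK_diag // in s1.
have KH2 : K ^+ 2 * H ^+ 2 <= 1 by rewrite -exprMn expr_le1.
have pB : 0 <= K ^+ 2 * H ^+ 2 <= B.
  by rewrite -exprMn sqr_ge0 /= exprMn; lra.
have [_ s2 _] := hG xceB p_small pB.
rewrite (_ : (fun j => x c + e j + p j) = y) in s2; last first.
  by apply/funext => j; rewrite -yE.
rewrite -/y -[gradK U y](subrK (gradK U (fun j => x c + e j))) -addrA.
rewrite (le_trans (ler_normD _ _)) //.
rewrite (_ : gradK U (fun j => x c + e j) + gradK U (fun j => x c + e j) - _
  = 2 *: (gradK U (fun j => x c + e j) - mgrad U (x c))) in s1; last by vec_ring.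
rewrite normrZ normr_nat in s1.
have K3 : 0 <= K ^+ 3 * H ^+ 2 by rewrite mulr_ge0 ?exprn_ge0 //; lra.
have E1 : K * (K * H) ^+ 2 = K ^+ 3 * H ^+ 2 by ring.
have E2 : K * (K ^+ 2 * H ^+ 2) = K ^+ 3 * H ^+ 2 by ring.
lra.
Qed.

Let a := d%:R * `|A|.
Let q := d%:R * `|Q|.
(** The terms bound, in this order, the midpoint rule, the term of order H A, the
remainder of phi, and the polarization error. *)
Definition local_error_const : R :=
  3 * K ^+ 3 + a * (K ^+ 2 + a * K)
  + 2 * d%:R * a ^+ 2 * (a * B + q * K) + 4 * d%:R * q * K ^+ 3.

(** Once phi(Z) is replaced by 1 + Z / 2 + rho, the terms of order H and H^2 combine
into the midpoint rule x(t + H) - x(t) - H F(x(c)) and into H A applied to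
x(c) - x(t) - (H / 2) F(x(c)) + (H / 2) A (x(c) - x(t)), both O(H^3). *)
Lemma local_error t h (H := k%:R * h) : 0 <= t -> 0 <= h -> t + H <= T ->
  K * H <= 1 -> d%:R * `|A| * H <= 1 / 2 ->
  `|x (t + H) - expmx (H *: A) *m x t
    - H *: (phimx (H *: A) *m Q *m gradK U (fun i : 'I_k.+1 => x (t + i%:R * h)))|
  <= local_error_const * H ^+ 3.
Proof.
have b2 := B2; have k1 := K1; have k0 : 0 <= K := le_trans ler01 k1.
move=> t0 h0 tT KH aH.
have H0 : 0 <= H by rewrite mulr_ge0.
have dZ : d%:R * `|H *: A| = a * H.
  by rewrite normrZ ger0_norm // /a; ring.
have hZ : d%:R * `|H *: A| <= 1 / 2 by rewrite dZ.
have a0 : 0 <= a by rewrite mulr_ge0.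
have q0 : 0 <= q by rewrite mulr_ge0.
set c := t + H / 2.
have tT' : 0 <= t <= T by lra.
have cT : 0 <= c <= T by rewrite /c; lra.
have ct : c - t = H / 2 by rewrite /c; ring.
have := phimx_expansion hZ; rewrite dZ.
have := phimx_norm hZ; rewrite (expmx_phimx hZ).
set phi := phimx (H *: A); set rho := phi - _ => phi2 rho2.
set X := x t; set Xc := x c; set X1 := x (t + H).
set G := gradK U _.
pose g := Q *m mgrad U Xc; pose gam := Q *m (G - mgrad U Xc).
have phiE (v : 'cV[R]_d) : phi *m v = v + (H / 2) *: (A *m v) + rho *m v.
  rewrite -[in LHS](subrKC (1%:M + (1 / 2) *: (H *: A)) phi) -/rho.
  rewrite !mulmxDl mul1mx scalerA -scalemxAl; congr (_ + _ *: _ + _).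
  by ring.
have expE : (1%:M + (H *: A) *m phi) *m X = X + H *: (A *m (phi *m X)).
  by rewrite mulmxDl mul1mx -!mulmxA -scalemxAl.
have QG : Q *m G = g + gam by rewrite /g /gam mulmxBr subrKC.
have E : X1 - (1%:M + (H *: A) *m phi) *m X - H *: (phi *m Q *m G)
   = (X1 - X - H *: F Xc)
     + H *: (A *m ((Xc - X - (H / 2) *: F Xc) + (H / 2) *: (A *m (Xc - X))))
     - H *: (A *m (rho *m X) + rho *m g + phi *m gam).
  rewrite expE -mulmxA QG mulmxDr !phiE /F -/g.
  rewrite !(mulmxDr, mulmxBr, mulmxN) -!scalemxAr !(mulmxDr, mulmxBr, mulmxN).
  move: (A *m (A *m X)) (A *m (A *m Xc)) (A *m X) (A *m Xc) (A *m g)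
    (A *m (rho *m X)) (rho *m g) (A *m gam) (rho *m gam) => *.
  by vec_field.
rewrite E {E}.
have K3 : 0 <= K ^+ 3 by exact: exprn_ge0.
have H3 : 0 <= H ^+ 3 by exact: exprn_ge0.
have XB : `|X| <= B by have := hxB tT'; have := normr_ge0 X; rewrite /X; lra.
have XcB : `|Xc| <= B by have := hxB cT; have := normr_ge0 Xc; rewrite /Xc; lra.
have KH2 : K * (H / 2) <= 1 by have := mulr_ge0 k0 H0; lra.
have n1 : `|X1 - X - H *: F Xc| <= 3 * K ^+ 3 * H ^+ 3.
  have := @trajectory_midpoint _ _ F T B K x hF hx hxB B2 K1 c (H / 2).
  rewrite (_ : c + H / 2 = t + H); last by rewrite /c; field.
  rewrite (_ : c - H / 2 = t); last by rewrite /c; ring.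
  rewrite (_ : 2 * (H / 2) = H); last by field.
  rewrite -/X1 -/X -/Xc => n1.
  apply: le_trans (n1 _ _ _ _) _ => //; try lra.
  rewrite ler_wpM2l ?lerXn2r ?nnegrE //; lra.
have nA (v : 'cV[R]_d) : `|A *m v| <= a * `|v| by exact: mulmx_norm.
have nQ (v : 'cV[R]_d) : `|Q *m v| <= q * `|v| by exact: mulmx_norm.
have n2 : `|(Xc - X - (H / 2) *: F Xc) + (H / 2) *: (A *m (Xc - X))|
    <= (K ^+ 2 + a * K) * H ^+ 2.
  have tc : t - c = - (H / 2) by rewrite /c; ring.
  have m1 := trajectory_first_order hF hx hxB B2 K1 tT' cT.
  rewrite tc normrN ger0_norm in m1; last by lra.
  have {}m1 := m1 KH2.
  have m2 := trajectory_lipschitz hF hx hxB B2 K1 cT tT'.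
  rewrite ct ger0_norm in m2; last by lra.
  rewrite (le_trans (ler_normD _ _)) // mulrDl lerD //.
    rewrite -normrN.
    rewrite (_ : - (_ - _ - _) = X - Xc - (- (H / 2)) *: F Xc); last first.
      by move: (F Xc) => w; vec_ring.
    rewrite (le_trans m1) // ler_wpM2l ?sqr_ge0 // lerXn2r ?nnegrE //; lra.
  rewrite normrZ ger0_norm; last by lra.
  have m3 : `|A *m (Xc - X)| <= a * (K * H).
    rewrite (le_trans (nA _)) // ler_wpM2l // (le_trans m2) // ler_wpM2l //; lra.
  rewrite (_ : a * K * H ^+ 2 = H * (a * (K * H))); last by ring.
  by rewrite ler_pM //; lra.
have nrho (v : 'cV[R]_d) : `|rho *m v| <= d%:R * (2 * (a * H) ^+ 2) * `|v|.
  by rewrite (le_trans (mulmx_norm _ _)) // ler_wpM2r // ler_wpM2l.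
have gK : `|g| <= q * K.
  rewrite (le_trans (nQ _)) // ler_wpM2l // -(gradK_diag hU).
  have r0 : (0 : R) <= 0 <= B by rewrite lexx /=; lra.
  have e0 (j : 'I_k.+1) : `|0 : 'cV[R]_d| <= 0 by rewrite normr0.
  by have [] := hG (fun=> XcB) e0 r0.
have ngam : `|gam| <= q * (2 * K ^+ 3 * H ^+ 2).
  by rewrite (le_trans (nQ _)) // ler_wpM2l //; apply: gradK_consistency.
have n3 : `|A *m (rho *m X) + rho *m g + phi *m gam|
    <= (2 * d%:R * a ^+ 2 * (a * B + q * K) + 4 * d%:R * q * K ^+ 3) * H ^+ 2.
  have m1 : `|A *m (rho *m X)| <= a * (d%:R * (2 * (a * H) ^+ 2) * B).
    rewrite (le_trans (nA _)) // ler_wpM2l // (le_trans (nrho _)) //.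
    by rewrite ler_wpM2l // !mulr_ge0 ?sqr_ge0.
  have m2 : `|rho *m g| <= d%:R * (2 * (a * H) ^+ 2) * (q * K).
    by rewrite (le_trans (nrho _)) // ler_wpM2l // !mulr_ge0 ?sqr_ge0.
  have m3 : `|phi *m gam| <= d%:R * 2 * (q * (2 * K ^+ 3 * H ^+ 2)).
    by rewrite (le_trans (mulmx_norm _ _)) // ler_pM // ?mulr_ge0 // ler_wpM2l.
  rewrite (le_trans (ler_normD _ _)) // (le_trans (lerD (ler_normD _ _) m3)) //.
  have := lerD m1 m2; lra.
rewrite (le_trans (ler_normB _ _)) // (le_trans (lerD (ler_normD _ _) (lexx _))) //.
have n2' : `|H *: (A *m ((Xc - X - (H / 2) *: F Xc) + (H / 2) *: (A *m (Xc - X))))|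
    <= H * (a * ((K ^+ 2 + a * K) * H ^+ 2)).
  by rewrite normrZ ger0_norm // ler_wpM2l // (le_trans (nA _)) // ler_wpM2l.
have n3' := ler_wpM2l H0 n3.
rewrite -[X in X * `|_ + _| <= _](ger0_norm H0) -normrZ in n3'.
rewrite (le_trans (lerD (lerD n1 n2') n3')) // /local_error_const.
by rewrite le_eqVlt; apply/orP; left; apply/eqP; ring.
Qed.
End LocalError.

(** * One step of the scheme *)

(** The kernel of 1 - L is trivial, hence 1 - L is invertible. *)
Lemma solve_contraction (R : realType) (d : nat) (L : 'M[R]_d) :
  (forall v : 'cV[R]_d, `|L *m v| <= `|v| / 2) ->
  forall b, exists v : 'cV[R]_d, v - L *m v = b.
Proof.
move=> hL b; have uL : 1%:M - L \in unitmx.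
  rewrite unitmxE unitfE -det_tr; apply/negP => /det0P[u u0].
  rewrite -[u]trmxK -trmx_mul => /(congr1 trmx); rewrite trmxK trmx0.
  rewrite mulmxBl mul1mx => /subr0_eq uE.
  have := hL u^T; rewrite -uE => le; case/eqP: u0.
  apply: (can_inj (@trmxK _ _ _)); rewrite trmx0; apply/eqP.
  by rewrite -normr_le0; have := normr_ge0 u^T; lra.
exists (invmx (1%:M - L) *m b).
by rewrite -{1}[invmx _ *m b]mul1mx -mulmxBl mulmxA mulmxV ?mul1mx.
Qed.

Section Step.
Variables (R : realType) (d k : nat) (Q A : 'M[R]_d) (U : mpoly.mpoly d R).
Variables (T B K : R) (x : R -> 'cV[R]_d).
Hypothesis hk : (0 < k)%N.
Hypothesis hU : (mpoly.msize U <= k.+3)%N.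
Let F v := A *m v + Q *m mgrad U v.
Hypothesis hG : gradK_regular k B K U.
Hypothesis hF : quad_regular_map B K F.
Hypothesis hx : has_deriv_on 0 T x (fun t => F (x t)).
Hypothesis hxB : forall t, 0 <= t <= T -> 2 * `|x t| <= B.
Hypothesis B2 : 2 <= B.
Hypothesis K1 : 1 <= K.

Let a := d%:R * `|A|.
Let q := d%:R * `|Q|.
Let theta := 4 * d%:R ^+ 2 * q * K.
Let c1 := 2 * d%:R * a + 2 * d%:R * q * K.
Let L := local_error_const Q A B K.

(** A bound on the sizes that must be small against 1 / H: the smallness
conditions of [local_error], the norm theta of the matrix of the linear system
divided by H, and the growth rate c1 of the error through the known values. *)
Definition step_stiffness : R := K + 2 * a + 2 * theta + c1.
(** For theta H <= 1 / 2 and c1 H <= 1, the quotient (1 + c1 H) / (1 - theta H) is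
at most 1 + (4 theta + c1) H. *)
Definition step_growth : R := k%:R * (4 * theta + c1) + 2 * L * k%:R ^+ 3.

(** The last entry of w is overwritten by the new value z, so that a whole window
of a numerical solution can be passed as it is. *)
Definition ekahan_step (h : R) (w : 'I_k.+1 -> 'cV[R]_d) (z : 'cV[R]_d) : Prop :=
  z = expmx ((k%:R * h) *: A) *m w ord0
    + (k%:R * h) *: (phimx ((k%:R * h) *: A) *m Q *m gradK U (set_arg ord_max w z)).

(** In terms of D = z - x(t + H) a step reads D - PL D = b, where b collects the
propagated errors and the local error, and |PL D| <= theta H |D|. *)
Lemma ekahan_step_stable (t h m : R) (w : 'I_k.+1 -> 'cV[R]_d) :
  0 <= t -> 0 <= h -> t + k%:R * h <= T -> step_stiffness * (k%:R * h) <= 1 ->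
  0 <= m <= 1 ->
  (forall i : 'I_k.+1, i != ord_max -> `|w i - x (t + i%:R * h)| <= m) ->
  [/\ exists z, ekahan_step h w z,
      forall z z', ekahan_step h w z -> ekahan_step h w z' -> z = z'
    & forall z, ekahan_step h w z ->
      `|z - x (t + k%:R * h)| <= (1 + step_growth * h) * m + step_growth * h ^+ 3].
Proof.
have b2 := B2; have k1 := K1; have k0 : 0 <= K := le_trans ler01 k1.
move=> t0 h0 tT stiff /andP[m0 m1] hw.
rewrite /ekahan_step; set H := k%:R * h in tT stiff *.
have H0 : 0 <= H by rewrite mulr_ge0.
have d0 : 0 <= d%:R :> R by [].
have a0 : 0 <= a by rewrite mulr_ge0.
have q0 : 0 <= q by rewrite mulr_ge0.
have th0 : 0 <= theta by rewrite !mulr_ge0 ?exprn_ge0.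
have c10 : 0 <= c1 by rewrite addr_ge0 ?mulr_ge0.
have L0 : 0 <= L.
  by rewrite /L /local_error_const -/a -/q;
    rewrite !addr_ge0 ?mulr_ge0 ?addr_ge0 ?mulr_ge0 ?exprn_ge0 //; lra.
have [KH aH thH c1H] : [/\ K * H <= 1, a * H <= 1 / 2, theta * H <= 1 / 2
    & c1 * H <= 1].
  have := mulr_ge0 k0 H0; have := mulr_ge0 a0 H0; have := mulr_ge0 th0 H0.
  have := mulr_ge0 c10 H0; move: stiff; rewrite /step_stiffness.
  by move=> *; split; lra.
have hZ : d%:R * `|H *: A| <= 1 / 2.
  by rewrite normrZ ger0_norm // mulrCA mulrC.
have err := local_error hU hG hF hx hxB B2 K1 t0 h0 tT KH aH.
rewrite -/H in err.
have := phimx_norm hZ; rewrite (expmx_phimx hZ) in err *.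
set phi := phimx (H *: A) in err * => phi2.
have n_phiQ (v : 'cV[R]_d) : `|phi *m Q *m v| <= 2 * d%:R * q * `|v|.
  rewrite -mulmxA (le_trans (mulmx_norm _ _)) //.
  rewrite [2 * _]mulrC -!mulrA mulrA [X in _ <= X]mulrA.
  by rewrite ler_pM ?mulr_ge0 // ?ler_wpM2l // mulrA mulmx_norm.
pose y (i : 'I_k.+1) := x (t + i%:R * h).
set xk := x (t + H).
have yk : y ord_max = xk by [].
have yT (i : 'I_k.+1) : 0 <= t + i%:R * h <= T.
  have : i%:R * h <= H by rewrite ler_wpM2r // ler_nat -ltnS.
  by have : 0 <= i%:R * h by [rewrite mulr_ge0]; lra.
have yB i : 2 * `|y i| <= B by exact: hxB.
have wB i : `|set_arg ord_max w xk i| <= B.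
  rewrite /set_arg; case: eqP => [_|/eqP ik].
    by have := yB ord_max; have := normr_ge0 xk; rewrite yk; lra.
  have := ler_normD (w i - y i) (y i); rewrite subrK.
  by have := hw i ik; have := yB i; rewrite -/(y i); lra.
have r0 : 0 <= B by lra.
pose G z := gradK U (set_arg ord_max w z).
pose Lz := gradK_lin U w.
have GE z z' : G z - G z' = Lz *m (z - z') by exact: gradK_affine.
have GB z : `|z| <= 1 -> `|G z| <= K.
  move=> z1; have e0 (j : 'I_k.+1) : `|0 : 'cV[R]_d| <= 0 by rewrite normr0.
  have vB i : `|set_arg ord_max w z i| <= B.
    have := wB i; rewrite /set_arg; case: ifP => // _ _.
    by rewrite (le_trans z1) // (le_trans _ b2) // ler1n.
  have rB : (0 : R) <= 0 <= B by rewrite lexx.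
  by have [] := hG vB e0 rB.
have LzB : `|Lz| <= 2 * K.
  apply: mx_norm_le => [|i j]; first by rewrite mulr_ge0.
  rewrite mxE (le_trans (le_mx_norm _ _ _)) // (le_trans (ler_normB _ _)) //.
  rewrite mulrDl mul1r lerD // GB ?normr0 //.
  by apply: mx_norm_le => // i' j'; rewrite mxE; case: (_ && _);
    rewrite ?normr1 ?normr0.
pose PL := H *: (phi *m Q *m Lz).
have PLn (v : 'cV[R]_d) : `|PL *m v| <= theta * H * `|v|.
  rewrite /PL -scalemxAl normrZ ger0_norm // -[_ *m _ *m _ *m v]mulmxA.
  rewrite (_ : theta * H * `|v| = H * (theta * `|v|)); last by ring.
  rewrite ler_wpM2l // (le_trans (n_phiQ _)) //.
  have : `|Lz *m v| <= d%:R * (2 * K) * `|v|.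
    by rewrite (le_trans (mulmx_norm _ _)) // ler_wpM2r // ler_wpM2l.
  move=> /(ler_wpM2l (_ : 0 <= 2 * d%:R * q)) le.
  rewrite (le_trans (le _)) ?mulr_ge0 // le_eqVlt.
  by apply/orP; left; apply/eqP; rewrite /theta; ring.
have PLhalf (v : 'cV[R]_d) : `|PL *m v| <= `|v| / 2.
  by rewrite (le_trans (PLn v)) // mulrC ler_wpM2l //; lra.
pose E0 := (1%:M + H *: A *m phi) *m w ord0.
pose b := E0 + H *: (phi *m Q *m G xk) - xk.
have eqE z : z = E0 + H *: (phi *m Q *m G z) <-> (z - xk) - PL *m (z - xk) = b.
  have GzE : H *: (phi *m Q *m G z)
      = H *: (phi *m Q *m G xk) + PL *m (z - xk).
    rewrite -[G z](subrK (G xk)) GE [in LHS]mulmxDr scalerDr addrC; congr (_ + _).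
    by rewrite /PL -scalemxAl mulmxA.
  rewrite GzE /b; move: (H *: _) (PL *m _) (E0) => u v w0; split.
    by move=> {1}->; vec_ring.
  by move=> e; rewrite -[LHS](subrK xk) -[z - xk](subrK v) e; vec_ring.
split.
- have [v hv] := solve_contraction PLhalf b.
  by exists (v + xk); apply/eqE; rewrite addrK.
- move=> z z' /eqE h1 /eqE h2; apply/subr0_eq/eqP.
  rewrite -normr_le0; have := PLhalf (z - z').
  have -> : PL *m (z - z') = z - z'.
    have -> : z - z' = (z - xk) - (z' - xk) by vec_ring.
    rewrite mulmxBr; move: (PL *m _) (PL *m _) h1 h2 => v u <- e.
    by rewrite -[u](subKr (z - xk)) -e; vec_ring.
  by have := normr_ge0 (z - z'); lra.
- move=> z /eqE zE.
set D := z - xk in zE *.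
have y0 : y ord0 = x t by rewrite /y mul0r addr0.
have w0 : `|w ord0 - x t| <= m.
  by rewrite -y0 hw // -val_eqE /= eq_sym -lt0n.
have wy i : `|set_arg ord_max w xk i - y i| <= m.
  rewrite /set_arg; case: eqP => [->|/eqP ik]; first by rewrite yk subrr normr0.
  exact: hw.
have yB' i : `|y i| <= B by have := yB i; have := normr_ge0 (y i); lra.
have mB : 0 <= m <= B by lra.
have [_ dG _] := hG yB' wy mB.
rewrite (_ : (fun j => y j + _) = set_arg ord_max w xk) in dG; last first.
  by apply/funext => j; rewrite subrKC.
rewrite -/y in err.
set e := x (t + H) - _ - _ in err.
have bE : b = (w ord0 - x t) + H *: (A *m (phi *m (w ord0 - x t)))
    + H *: (phi *m Q *m (G xk - gradK U y)) - e.
  rewrite /b /e -/xk /E0 !mulmxDl !mul1mx -!scalemxAl -!mulmxA !mulmxBr.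
  move: (A *m (phi *m w ord0)) (A *m (phi *m x t)) (phi *m (Q *m G xk))
    (phi *m (Q *m gradK U y)) => *; vec_ring.
have n1 : `|H *: (A *m (phi *m (w ord0 - x t)))| <= H * (2 * d%:R * a * m).
  rewrite normrZ ger0_norm // ler_wpM2l // (le_trans (mulmx_norm _ _)) //.
  rewrite (_ : 2 * d%:R * a * m = a * (d%:R * 2 * m)); last by ring.
  rewrite ler_wpM2l // (le_trans (mulmx_norm _ _)) // ler_pM ?mulr_ge0 //.
  by rewrite ler_wpM2l.
have n2 : `|H *: (phi *m Q *m (G xk - gradK U y))| <= H * (2 * d%:R * q * (K * m)).
  rewrite normrZ ger0_norm // ler_wpM2l // (le_trans (n_phiQ _)) //.
  by rewrite ler_wpM2l // !mulr_ge0.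
have nb : `|b| <= (1 + c1 * H) * m + L * H ^+ 3.
  rewrite bE (le_trans (ler_normB _ _)) // lerD //.
  rewrite (le_trans (ler_normD _ _)) // (le_trans (lerD (ler_normD _ _) n2)) //.
  have := lerD w0 n1; rewrite /c1; lra.
have nD : `|D| * (1 - theta * H) <= `|b|.
  have := ler_normD b (PL *m D); rewrite -zE subrK.
  by have := PLn D; rewrite zE; lra.
have thH0 := mulr_ge0 th0 H0; have c1H0 := mulr_ge0 c10 H0.
have LH0 : 0 <= L * H ^+ 3 by rewrite mulr_ge0 ?exprn_ge0.
(* 1 / (1 - u) <= 1 + 2 u for 0 <= u <= 1 / 2. *)
have Dle : `|D| <= (1 + 2 * (theta * H)) * `|b|.
  have : `|D| <= (1 + 2 * (theta * H)) * (`|D| * (1 - theta * H)).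
    rewrite mulrCA ler_peMr // -subr_ge0.
    rewrite (_ : _ - 1 = theta * H * (1 - 2 * (theta * H))); last by ring.
    by rewrite mulr_ge0 //; lra.
  by move=> /le_trans; apply; rewrite ler_wpM2l //; lra.
rewrite (le_trans Dle) //.
rewrite (le_trans (ler_wpM2l (_ : 0 <= 1 + 2 * (theta * H)) nb)) //; first by lra.
rewrite mulrDr lerD //.
  rewrite [leLHS]mulrA ler_wpM2r // (_ : step_growth * h =
    (4 * theta + c1) * H + 2 * L * k%:R ^+ 3 * h); last first.
    by rewrite /step_growth /H; ring.
  have h3 : 0 <= 2 * L * k%:R ^+ 3 * h by rewrite !mulr_ge0 ?exprn_ge0.
  have : theta * H * (c1 * H) <= theta * H by rewrite ler_piMr.
  lra.
apply: (@le_trans _ _ (2 * (L * H ^+ 3))); first by rewrite ler_wpM2r //; lra.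
rewrite (_ : step_growth * h ^+ 3 =
  k%:R * (4 * theta + c1) * h ^+ 3 + 2 * (L * H ^+ 3)); last first.
  by rewrite /step_growth /H; ring.
by rewrite lerDr !mulr_ge0 ?exprn_ge0 // addr_ge0 ?mulr_ge0.
Qed.
End Step.

(** * Error propagation and convergence *)

Lemma gradK_regularW (R : realType) (d k : nat) (B K K' : R)
    (U : mpoly.mpoly d R) :
  K <= K' -> gradK_regular k B K U -> gradK_regular k B K' U.
Proof.
move=> KK hG v e r vB er rB; have [h1 h2 h3] := hG v e r vB er rB.
have /andP[r0 _] := rB.
split; first exact: le_trans KK.
- by rewrite (le_trans h2) // ler_wpM2r.
- by rewrite (le_trans h3) // ler_wpM2r // sqr_ge0.
Qed.

Lemma quad_regular_mapW (R : realType) (d : nat) (B K K' : R)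
    (F : 'cV[R]_d -> 'cV[R]_d) :
  K <= K' -> quad_regular_map B K F -> quad_regular_map B K' F.
Proof.
move=> KK hF v e r vB er rB; have [h1 h2 h3] := hF v e r vB er rB.
have /andP[r0 _] := rB.
split; first exact: le_trans KK.
- by rewrite (le_trans h2) // ler_wpM2r.
- by rewrite (le_trans h3) // ler_wpM2r // sqr_ge0.
Qed.

Lemma vector_field_regular (R : realType) (d k : nat) (Q A : 'M[R]_d)
    (B K : R) (U : mpoly.mpoly d R) :
  (mpoly.msize U <= k.+3)%N -> 0 <= B -> 0 <= K -> gradK_regular k B K U ->
  quad_regular_map B (d%:R * `|A| * (B + 1) + d%:R * `|Q| * K)
    (fun v => A *m v + Q *m mgrad U v).
Proof.
move=> hU B0 K0 hG v e r vB er rB.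
have [] := @hG (fun=> v) (fun=> e) r (fun=> vB) (fun=> er) rB.
rewrite !(gradK_diag hU) => h1 h2 h3; have /andP[r0 rB'] := rB.
have a0 : 0 <= d%:R * `|A| by rewrite mulr_ge0.
have q0 : 0 <= d%:R * `|Q| by rewrite mulr_ge0.
move: h1 h2 h3; set g := mgrad U v; set gp := mgrad U (v + e).
set gm := mgrad U (v - e) => h1 h2 h3.
have nA (u : 'cV[R]_d) : `|A *m u| <= d%:R * `|A| * `|u| by exact: mulmx_norm.
have nQ (u : 'cV[R]_d) : `|Q *m u| <= d%:R * `|Q| * `|u| by exact: mulmx_norm.
split.
- rewrite (le_trans (ler_normD _ _)) // lerD //.
    by rewrite (le_trans (nA v)) // ler_wpM2l // (le_trans vB) // lerDl.
  by rewrite (le_trans (nQ g)) // ler_wpM2l.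
- have -> : A *m (v + e) + Q *m gp - (A *m v + Q *m g)
      = A *m e + Q *m (gp - g).
    rewrite mulmxDr mulmxBr.
    move: (A *m v) (A *m e) (Q *m g) (Q *m gp) => *; vec_ring.
  rewrite (le_trans (ler_normD _ _)) // mulrDl lerD //.
    rewrite (le_trans (nA e)) // -[leRHS]mulrA ler_wpM2l // (le_trans er) //.
    by rewrite mulrDl mul1r lerDr mulr_ge0.
  by rewrite (le_trans (nQ _)) // -[leRHS]mulrA ler_wpM2l.
- have -> : A *m (v + e) + Q *m gp + (A *m (v - e) + Q *m gm)
      - (A *m v + Q *m g) *+ 2 = Q *m (gp + gm - g *+ 2).
    rewrite !mulr2n !(mulmxBr, mulmxDr).
    move: (A *m v) (A *m e) (Q *m g) (Q *m gp) (Q *m gm) => *; vec_ring.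
  rewrite (le_trans (nQ _)) // (le_trans (ler_wpM2l q0 h3)) // mulrDl
    -[X in _ <= _ + X]mulrA.
  by rewrite lerDr !mulr_ge0 ?sqr_ge0 ?addr_ge0.
Qed.

Section Convergence.
Variables (R : realType) (d k : nat) (Q M : 'M[R]_d) (U : mpoly.mpoly d R).
Variables (T C kappa h : R) (x : R -> 'cV[R]_d) (s : 'I_k -> 'cV[R]_d).
Hypothesis hk : (0 < k)%N.
Hypothesis h_gt0 : 0 < h.
Hypothesis kappa0 : 0 <= kappa.
Hypothesis C0 : 0 <= C.

(** Closed form of the recursion [error_boundS] with value C h^2 at 0. *)
Definition error_bound (n : nat) : R :=
  (1 + kappa * h) ^+ n * ((C + 1) * h ^+ 2) - h ^+ 2.

Hypothesis hstep : forall (t m : R) (w : 'I_k.+1 -> 'cV[R]_d),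
  0 <= t -> t + k%:R * h <= T -> 0 <= m <= 1 ->
  (forall i : 'I_k.+1, i != ord_max -> `|w i - x (t + i%:R * h)| <= m) ->
  [/\ exists z, ekahan_step Q (Q *m M) U h w z,
      forall z z', ekahan_step Q (Q *m M) U h w z ->
        ekahan_step Q (Q *m M) U h w z' -> z = z'
    & forall z, ekahan_step Q (Q *m M) U h w z ->
      `|z - x (t + k%:R * h)| <= (1 + kappa * h) * m + kappa * h ^+ 3].
Hypothesis hs : forall j : 'I_k, j%:R * h <= T ->
  `|s j - x (j%:R * h)| <= C * h ^+ 2.
Hypothesis h_small : forall n : nat, n%:R * h <= T -> error_bound n <= 1.

Lemma error_boundS n :
  error_bound n.+1 = (1 + kappa * h) * error_bound n + kappa * h ^+ 3.
Proof. by rewrite /error_bound exprS; ring. Qed.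

Lemma error_bound_mono : {homo error_bound : m n / (m <= n)%N >-> m <= n}.
Proof.
have kh : 0 <= kappa * h by rewrite mulr_ge0 // ltW.
move=> m n mn; rewrite lerD2r ler_wpM2r //.
  by rewrite mulr_ge0 ?sqr_ge0 // addr_ge0.
by rewrite ler_weXn2l // lerDl.
Qed.

Lemma error_bound0 : error_bound 0 = C * h ^+ 2.
Proof. by rewrite /error_bound expr0; ring. Qed.

Lemma error_bound_ge n : C * h ^+ 2 <= error_bound n.
Proof. by rewrite -error_bound0 error_bound_mono. Qed.

Lemma scheme_stepE (y : nat -> 'cV[R]_d) n :
  (y (n + k)%N =
      expmx ((k%:R * h) *: (Q *m M)) *m y n
      + (k%:R * h) *: (phimx ((k%:R * h) *: (Q *m M)) *m Q
                         *m gradK U (fun i : 'I_k.+1 => y (n + i)%N)))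
  <-> ekahan_step Q (Q *m M) U h (fun i : 'I_k.+1 => y (n + i)%N) (y (n + k)%N).
Proof.
rewrite /ekahan_step addn0.
by rewrite (_ : set_arg ord_max _ _ = fun i : 'I_k.+1 => y (n + i)%N) //;
  apply/funext => i; rewrite /set_arg; case: eqP => [->|].
Qed.

(** All values of a window have an error at most [error_bound] at the last known
index, which is at most 1: the hypotheses of a stable step. *)
Lemma window_error (y : nat -> 'cV[R]_d) (N n : nat) : (n + k)%:R * h <= T ->
  (n + k <= N.+1)%N ->
  (forall j, (j <= N)%N -> `|y j - x (j%:R * h)| <= error_bound j) ->
  [/\ 0 <= n%:R * h, n%:R * h + k%:R * h <= T,
    0 <= error_bound (n + k).-1 <= 1
    & forall i : 'I_k.+1, i != ord_max ->
      `|y (n + i)%N - x (n%:R * h + i%:R * h)| <= error_bound (n + k).-1].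
Proof.
have hp := ltW h_gt0; move=> nT nN hy; split.
- by rewrite mulr_ge0.
- by rewrite -mulrDl -natrD.
- rewrite (le_trans _ (error_bound_ge _)) ?mulr_ge0 ?sqr_ge0 //= h_small //.
  by rewrite (le_trans _ nT) // ler_wpM2r // ler_nat leq_pred.
- move=> i ik; rewrite -mulrDl -natrD.
  have {}ik : (i < k)%N by rewrite ltn_neqAle ik -ltnS ltn_ord.
  have le : (n + i <= (n + k).-1)%N.
    by rewrite -ltnS prednK ?ltn_add2l ?addn_gt0 ?hk ?orbT.
  rewrite (le_trans (hy _ _)) ?error_bound_mono //.
  by rewrite (leq_trans le) // -ltnS prednK ?addn_gt0 ?hk ?orbT.
Qed.

(** The error bound is part of the induction, since solvability of the next step
requires the known values to be close to the exact solution. *)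
Lemma ekahan_solution_exists N : N%:R * h <= T ->
  exists2 y, ekahan_solution Q M U h N s y &
    forall n, (n <= N)%N -> `|y n - x (n%:R * h)| <= error_bound n.
Proof.
have hp := ltW h_gt0.
have start (y : nat -> 'cV[R]_d) n : (forall j : 'I_k, y j = s j) ->
    (n < k)%N -> n%:R * h <= T -> `|y n - x (n%:R * h)| <= error_bound n.
  move=> ys nk nT; rewrite (le_trans _ (error_bound_ge n)) //.
  by rewrite (ys (Ordinal nk)); exact: (@hs (Ordinal nk) nT).
elim: N => [|N IH] NT.
  pose y n : 'cV[R]_d := if insub n is Some j then s j else 0.
  have ys (j : 'I_k) : y j = s j by rewrite /y valK.
  exists y => [|n]; last by rewrite leqn0 => /eqP ->; apply: start.
  by split => // n; rewrite leqn0 addn_eq0 -[k == _]negbK -lt0n hk andbF.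
have [|y [ys yN] yE] := IH; first by rewrite (le_trans _ NT) // ler_wpM2r // ler_nat.
have [Nk|kN] := ltnP N.+1 k.
  exists y => [|n]; last first.
    by rewrite leq_eqVlt => /predU1P[->|/yE //]; apply: start.
  split=> // n nN; exfalso; move: nN; apply/negP; rewrite -ltnNge.
  exact: leq_trans Nk (leq_addl _ _).
pose n := (N.+1 - k)%N; have nk : (n + k)%N = N.+1 by rewrite subnK.
have nT : (n + k)%:R * h <= T by rewrite nk.
have nN : (n + k <= N.+1)%N by rewrite nk.
have [t0 tT mle hw] := window_error nT nN yE.
have [[z hz] _ /(_ z hz) zE] := hstep t0 tT mle hw.
pose y' j := if j == N.+1 then z else y j.
have y'E j : (j <= N)%N -> y' j = y j by move=> jN; rewrite /y' ltn_eqF.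
have y'N : y' N.+1 = z by rewrite /y' eqxx.
exists y'; last first.
  move=> j; rewrite leq_eqVlt => /predU1P[->|jN]; last by rewrite y'E ?yE.
  by rewrite y'N error_boundS -nk natrD mulrDl (le_trans zE) // nk.
split=> [j|j jN].
  by rewrite y'E // -ltnS (leq_trans (ltn_ord j)).
move: jN; rewrite leq_eqVlt => /predU1P[jN|jN].
  have -> : j = n by apply/eqP; rewrite -(eqn_add2r k) jN nk.
  apply/scheme_stepE; rewrite nk y'N.
  move: hz; rewrite /ekahan_step !addn0 y'E; last first.
    by rewrite -ltnS -nk -[X in (X < _)%N]addn0 ltn_add2l.
  rewrite (_ : set_arg ord_max (fun i : 'I_k.+1 => y' (n + i)%N) z
    = set_arg ord_max (fun i : 'I_k.+1 => y (n + i)%N) z) //.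
  apply/funext => i; rewrite /set_arg; case: eqP => // /eqP ik.
  rewrite y'E // -ltnS -nk ltn_add2l ltn_neqAle -ltnS ltn_ord andbT.
  exact: ik.
rewrite y'E // yN // y'E; last by rewrite (leq_trans (leq_addr k j)).
congr (_ + _ *: (_ *m gradK U _)); apply/funext => i.
by rewrite y'E // -ltnS (leq_trans _ jN) // ltnS leq_add2l -ltnS.
Qed.

Lemma ekahan_solution_unique N (y z : nat -> 'cV[R]_d) : N%:R * h <= T ->
  ekahan_solution Q M U h N s y -> ekahan_solution Q M U h N s z ->
  (forall n, (n <= N)%N -> `|y n - x (n%:R * h)| <= error_bound n) ->
  forall n, (n <= N)%N -> z n = y n.
Proof.
have hp := ltW h_gt0; move=> NT [ys yS] [zs zS] yE n.
elim/ltn_ind: n => n IH nN; have [nk|kn] := ltnP n k.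
  by rewrite (zs (Ordinal nk)) (ys (Ordinal nk)).
pose j := (n - k)%N; have jk : (j + k)%N = n by rewrite subnK.
have jN : (j + k <= N)%N by rewrite jk.
have jT : (j + k)%:R * h <= T.
  by rewrite (le_trans _ NT) // ler_wpM2r // ler_nat.
have [t0 tT mle hw] := window_error jT (leqW jN) yE.
have [_ uniq _] := hstep t0 tT mle hw.
rewrite -jk; apply: uniq; last exact/scheme_stepE/yS.
have /scheme_stepE := zS j jN; rewrite /ekahan_step !addn0.
rewrite (IH j); last 2 first.
- by rewrite -jk -[X in (X < _)%N]addn0 ltn_add2l.
- by rewrite (leq_trans (leq_addr k j)).
move=> {1}->; congr (_ + _ *: (_ *m gradK U _)); apply/funext => i.
rewrite /set_arg; case: eqP => // /eqP ik; apply: IH.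
  by rewrite -jk ltn_add2l ltn_neqAle ik -ltnS ltn_ord.
by rewrite (leq_trans _ jN) // leq_add2l -ltnS.
Qed.
End Convergence.

Unset Implicit Arguments.
Set Strict Implicit.
Set Printing Implicit Defensive.

Theorem theorem5 (R : realType) (d k : nat) (hk : (1 <= k)%N)
    (nrm : 'cV[R]_d -> R) (hnrm : vector_norm nrm)
    (Q M : 'M[R]_d) (hQ : Q^T = - Q) (hM : M^T = M)
    (U : mpoly.mpoly d R) (hU : mpoly.msize U = k.+3)
    (T : R) (hT : 0 < T) (x : R -> 'cV[R]_d)
    (hx : solves_ode (fun v => Q *m M *m v + Q *m mgrad U v) T x)
    (D : set 'cV[R]_d) (hD : exists B : R, forall v, D v -> nrm v <= B)
    (hxD : forall t, t \in `[0, T] -> D (x t))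
    (C : R) (hC : 0 < C) (s : R -> 'I_k -> 'cV[R]_d)
    (hs : forall h, 0 < h -> forall j : 'I_k, j%:R * h <= T ->
            nrm (s h j - x (j%:R * h)) <= C * h ^+ 2) :
  exists h0 CT : R, 0 < h0 /\ 0 < CT /\
    forall h : R, 0 < h -> h <= h0 ->
      let N := Num.truncn (T / h) in
      exists y : nat -> 'cV[R]_d,
        [/\ ekahan_solution Q M U h N (s h) y,
            forall z, ekahan_solution Q M U h N (s h) z ->
              forall n, (n <= N)%N -> z n = y n
          & \big[Num.max/0]_(n < N.+1) nrm (y n - x (n%:R * h))
              <= CT * h ^+ 2].
Proof.
have [c1 c10 nrm_le] := vector_norm_le_sup hnrm.
have [c2 c20 sup_le] := sup_le_vector_norm hnrm.
have [B0 hB0] := hD.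
(* Twice a bound on the exact solution leaves room for a point of the solution
   plus half the difference of two others; the summand 2 leaves room for
   numerical values at distance at most 1. *)
set B : R := 2 + 2 * (c2 * `|B0|).
have B2 : 2 <= B by rewrite lerDl mulr_ge0 // mulr_ge0 // ltW.
have Bge0 : 0 <= B by lra.
have xB t : 0 <= t <= T -> 2 * `|x t| <= B.
  move=> tT; have xt := hB0 _ (hxD t _); rewrite in_itv /= in xt.
  rewrite -[leLHS]add0r lerD // ler_wpM2l // (le_trans (sup_le _)) //.
  by rewrite ler_wpM2l ?(ltW c20) // (le_trans (xt tT)) // ler_norm.
have msU : (mpoly.msize U <= k.+3)%N by rewrite hU.
have [K0 K00 hG0] := gradK_quad_regular k U Bge0.
pose A := Q *m M.
have a0 : 0 <= d%:R * `|A| * (B + 1) by rewrite !mulr_ge0 // addr_ge0.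
have q0 : 0 <= d%:R * `|Q| * K0 by rewrite !mulr_ge0.
pose K := 1 + K0 + (d%:R * `|A| * (B + 1) + d%:R * `|Q| * K0).
have K1 : 1 <= K by rewrite /K; lra.
have hG : gradK_regular k B K U by apply: gradK_regularW hG0; rewrite /K; lra.
have hF : quad_regular_map B K (fun v => A *m v + Q *m mgrad U v).
  apply: quad_regular_mapW (vector_field_regular Q A msU Bge0 K00 hG0).
  by rewrite /K; lra.
have hder := solves_ode_has_deriv hx.
pose S := step_stiffness Q A K; pose g := step_growth k Q A B K.
pose kappa := `|g| + 1; pose C' := c2 * C.
have kappa0 : 0 <= kappa by rewrite addr_ge0.
have C'0 : 0 <= C' by rewrite mulr_ge0 // ltW.
pose E := expR (kappa * T).
have E0 : 0 < E by exact: expR_gt0.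
have EC : 0 < E * (C' + 1) by rewrite mulr_gt0 // ltr_wpDl.
have kS : 0 < k%:R * (`|S| + 1) :> R by rewrite mulr_gt0 ?ltr0n // ltr_wpDl.
(* The second term makes a step solvable and stable; with the third, the
   accumulated error stays below 1. *)
exists (Num.min 1 (Num.min (k%:R * (`|S| + 1))^-1 (E * (C' + 1))^-1)).
exists (c1 * (E * (C' + 1))); split; first by rewrite !lt_min ltr01 !invr_gt0 kS.
split; first exact: mulr_gt0.
move=> h h0; rewrite !le_min => /and3P[h1 hS hE] N.
have hp := ltW h0.
have stiff : S * (k%:R * h) <= 1.
  apply: (@le_trans _ _ ((`|S| + 1) * (k%:R * h))).
    rewrite ler_wpM2r ?mulr_ge0 //; have := ler_norm S; lra.
  by rewrite mulrA -ler_pdivlMl ?[_ * k%:R]mulrC // mulr1.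
have step (t m : R) (w : 'I_k.+1 -> 'cV[R]_d) : 0 <= t -> t + k%:R * h <= T ->
    0 <= m <= 1 ->
    (forall i : 'I_k.+1, i != ord_max -> `|w i - x (t + i%:R * h)| <= m) ->
    [/\ exists z, ekahan_step Q A U h w z,
        forall z z', ekahan_step Q A U h w z -> ekahan_step Q A U h w z' -> z = z'
      & forall z, ekahan_step Q A U h w z ->
      `|z - x (t + k%:R * h)| <= (1 + kappa * h) * m + kappa * h ^+ 3].
  move=> t0 tT m01 hw.
  have [ex uniq err] :=
    ekahan_step_stable hk msU hG hF hder xB B2 K1 t0 hp tT stiff m01 hw.
  split=> // z hz; rewrite (le_trans (err z hz)) //.
  have gk : g <= kappa by rewrite /kappa; have := ler_norm g; lra.
  have /andP[m0 _] := m01.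
  by rewrite lerD // ?ler_wpM2r ?exprn_ge0 // lerD2l ler_wpM2r.
have hs' (j : 'I_k) : j%:R * h <= T -> `|s h j - x (j%:R * h)| <= C' * h ^+ 2.
  move=> jT; rewrite (le_trans (sup_le _)) // /C' -mulrA ler_wpM2l ?(ltW c20) //.
  exact: hs.
have bound n : n%:R * h <= T -> error_bound C' kappa h n <= E * (C' + 1) * h ^+ 2.
  move=> nT; rewrite /error_bound lerBlDr -[leLHS]addr0 lerD ?sqr_ge0 //.
  rewrite mulrA ler_wpM2r ?sqr_ge0 // ler_wpM2r ?addr_ge0 //.
  rewrite (@le_trans _ _ (expR (kappa * h) ^+ n)) //.
    by rewrite lerXn2r ?nnegrE ?expR_ge0 ?expR_ge1Dx // addr_ge0 // mulr_ge0.
  by rewrite -expRM_natl ler_expR mulrCA ler_wpM2l.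
have small n : n%:R * h <= T -> error_bound C' kappa h n <= 1.
  move=> /bound /le_trans; apply; rewrite expr2 mulrA.
  rewrite (@le_trans _ _ (E * (C' + 1) * h)) //.
    by rewrite ler_piMr // mulr_ge0 // ltW.
  by rewrite -ler_pdivlMl // mulr1.
have NT n : (n <= N)%N -> n%:R * h <= T.
  by rewrite truncn_ge_nat ?divr_ge0 ?(ltW hT) // ler_pdivlMr.
have [y ysol yerr] :=
  ekahan_solution_exists hk h0 kappa0 C'0 step hs' small (NT N (leqnn N)).
exists y; split=> //.
  move=> z zsol.
  apply: (ekahan_solution_unique hk h0 kappa0 C'0 step small _ ysol zsol yerr).
  exact: NT.
apply: bigmax_le => [|n _].
  by rewrite mulr_ge0 ?sqr_ge0 // mulr_ge0 // ltW.
have nN : (n <= N)%N by rewrite -ltnS.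
rewrite (le_trans (nrm_le _)) // -[leRHS]mulrA ler_wpM2l ?(ltW c10) //.
exact: le_trans (yerr n nN) (bound n (NT n nN)).
Qed.
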